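(* Let $(X(p))_{p \text{ prime}}$ be independent random variables, each taking the values $+1$ and $-1$ with probability $1/2$. Define $X(n)=0$ if $n$ is divisible by the square of a prime, and $X(n)=\prod_{j=1}^k X(p_j)$ if $n=p_1\cdots p_k$ is square-free with distinct primes $p_j$ (so $X(1)=1$). Let $x$ and $y$ be large natural numbers with $y=\delta x$ for some $\delta<1/10$. Let $S=S(x,y)$ denote the number of square-free integers in $[x,x+y]$. Let $Z$ be a Gaussian random variable with mean $0$ and variance $1$, and let $\phi:\mathbb{R}\to\mathbb{R}$ satisfy $|\phi(\alpha)-\phi(\beta)|\le|\alpha-\beta|$ for all real $\alpha,\beta$. Then $$\Big|\mathbb{E}\Big(\phi\Big(\frac{1}{\sqrt S}\sum_{x<n\le x+y}X(n)\Big)\Big)-\mathbb{E}\,\phi(Z)\Big|$$ is bounded by an absolute constant times $$\min\Big(1,\ \Big(\frac{y}{S}\Big)^{3/2}\frac{1}{(\log 1/\delta)^{1/2}}+\frac{y}{S}\sqrt{\delta\log x}+\frac{y\log x}{S^{3/2}\log y}\Big).$$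
   Context: $X$ is called a random multiplicative function. The constant in the bound does not depend on $x$, $y$, $\delta$, $\phi$. *)

(* Defs.v *)
From HB Require Import structures.
From mathcomp Require Import all_boot all_order all_algebra finmap.
From mathcomp Require Import all_classical all_reals all_analysis.

Set Implicit Arguments.
Unset Strict Implicit.
Unset Printing Implicit Defensive.

Import Order.TTheory GRing.Theory Num.Theory.
Import numFieldNormedType.Exports.

Local Open Scope classical_set_scope.
Local Open Scope ring_scope.

Definition squarefree (n : nat) : bool :=
  (0 < n)%N && all (fun p => ~~ (p ^ 2 %| n)%N) (primes n).

Lemma squarefreeP (n : nat) :
  reflect (forall p, prime p -> ~~ (p ^ 2 %| n)%N) (squarefree n).
Proof.
apply: (iffP andP) => [[n0 /allP sqf] p pp|sqf].
  apply/negP => p2n; have pn : (p %| n)%N by apply: dvdn_trans p2n; exact: dvdn_mulr.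
  by have /negP := sqf p (etrans (mem_primes p n) (introT and3P (And3 pp n0 pn))).
split; last by apply/allP => p; rewrite mem_primes => /andP[/sqf].
by case: n sqf => // /(_ 2%N isT).
Qed.

(* The number of square-free integers in the closed interval [x, x + y]. *)
Definition squarefree_count (x y : nat) : nat :=
  count squarefree (index_iota x (x + y).+1).

(* Extension of a function f on the primes: 0 at integers that are not
   square-free, and f p_1 * ... * f p_k at p_1 ... p_k with distinct primes p_j
   ([primes n] lists each prime divisor of n exactly once). *)
Definition squarefree_ext (R : realType) (f : nat -> R) (n : nat) : R :=
  if squarefree n then \prod_(p <- primes n) f p else 0.

(* Mutual independence of the random variables (X i), i ranging over D. *)
Definition mutually_independent (d : measure_display) (T : measurableType d)
    (R : realType) (P : probability T R) (I : choiceType) (D : set I)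
    (X : I -> {RV P >-> R}) : Prop :=
  forall (J : {fset I}) (B : I -> set R),
    [set` J] `<=` D -> (forall i, measurable (B i)) ->
    P (\bigcap_(i in [set` J]) (X i @^-1` B i)) =
    (\prod_(i <- J) P (X i @^-1` B i))%E.

(* [normal_prob m s] has mean m and standard deviation s. *)
Definition is_standard_gaussian (d : measure_display) (T : measurableType d)
    (R : realType) (P : probability T R) (Z : {RV P >-> R}) : Prop :=
  forall A : set R, measurable A -> distribution P Z A = normal_prob 0 1 A.

(* Main.v *)
(** For a prime [p], let [R_p] be the sum of [X(n)] over those [n] of the band
    whose selected large prime factor is [p], and let [U_p] be the sum of [X(n)]
    over the multiples [n] of [p]. Flipping the sign [X(p)] negates [R_p] and
    moves the whole sum by [2 U_p]. Inserting this in Stein's equation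
    [g' - w g = phi - E phi(Z)] bounds the distance to the Gaussian by the
    fluctuation of [sum_p R_p U_p] around its mean and by [sum_p E |R_p| U_p^2].
    Expanding the second and fourth moments, both reduce to counting the
    quadruples of squarefree integers of the band whose product is a square.
    Such quadruples factor as [n1 = g u v], [n2 = g t s], [n3 = g' u s],
    [n4 = g' t v]; the ratios [g / g'], [u / t], [v / s] are within [1 + delta] of
    [1], and at least two of these pairs are nontrivial off the diagonal. Every
    squarefree [n > x] has a prime factor larger than a constant times [log x],
    because the primes up to [z = 2^k] have product at most [4^z]; this makes the
    diagonal terms small, and no conditioning on the small primes is needed. *)

Require Import Defs.
From HB Require Import structures.
From mathcomp Require Import all_boot all_order all_algebra finmap.
From mathcomp Require Import all_classical all_reals all_analysis.
From mathcomp Require Import measurable_realfun ring lra zify.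
Import Order.TTheory GRing.Theory Num.Theory.
Import numFieldNormedType.Exports.
Local Open Scope classical_set_scope.
Local Open Scope ring_scope.

Set Implicit Arguments.
Unset Strict Implicit.
Unset Printing Implicit Defensive.

(** * Stein's equation *)

(** The first term is proved with [log x] in place of [log (1/delta)], which is no larger because
    [1/delta = x/y <= x]. Splitting by a large prime factor is what makes the pieces small: a prime
    [p > z] has at most [y/p + 1] multiples in the band, and the sum of [1/p^2] over [p > z] is at
    most [1/z], of order [1/log x]. The term [sqrt (delta log x)] comes from the nontrivial square
    products: one nontrivial near pair costs [delta] times a harmonic sum. The third term only has
    to absorb [1/sqrt S], which stems from the Taylor remainder at primes [p > y] and from the
    endpoint [x], counted in [S] but absent from the sum. When [delta log x > 1] the claimed bound
    is at least a constant and a second moment suffices. Since [phi] is merely Lipschitz, the bounds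
    on [g'] and on its Lipschitz constant cannot go through [phi']; they come from comparison with
    explicit barriers, uniformly in [phi]. *)

Section SteinEquation.
Context {R : realType}.
Implicit Types (f m b : R -> R) (t w e M K : R).

Lemma is_derive_MVT f (df : R -> R) (u v : R) : u <= v ->
  (forall t, u <= t <= v -> is_derive t 1 f (df t)) ->
  exists2 c, u <= c <= v & f v - f u = df c * (v - u).
Proof.
move=> uv dfE.
have dfE' t : t \in `]u, v[ -> is_derive t 1 f (df t).
  by rewrite in_itv/= => /andP[ut tv]; apply: dfE; rewrite !ltW.
have [|c cuv ->] := @MVT_segment R f df u v uv dfE'.
  apply: derivable_within_continuous => t; rewrite in_itv/= => tuv.
  by have [] := dfE _ tuv.
by exists c => //; move: cuv; rewrite in_itv.
Qed.

Lemma gaussian_derive t :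
  is_derive t 1 (normal_pdf 0 1 : R -> R) (- t * normal_pdf 0 1 t).
Proof.
have -> : normal_pdf 0 1 =
    (fun t : R => @normal_peak R 1 * expR (- (t * t) / 2)).
  apply/funext => s; rewrite normal_pdfE ?oner_eq0//=.
  by rewrite /normal_fun subr0 expr1n mulr2n expr2.
apply: is_derive_eq => /=.
rewrite /GRing.scale/=; lra.
Qed.

Lemma gaussian_gt0 t : 0 < normal_pdf 0 1 t :> R.
Proof.
by rewrite normal_pdfE ?oner_eq0// mulr_gt0 ?expR_gt0 ?normal_peak_gt0 ?oner_eq0.
Qed.

(* If [f' = t f + m] and [b' <= t b - |m|], then the product of [f - b] and the
   Gaussian density is nondecreasing; as it tends to [0], it is nonpositive. *)
Lemma stein_barrier f m b (db : R -> R) :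
  (forall t, is_derive t 1 f (t * f t + m t)) ->
  (forall t, 0 <= t -> is_derive t 1 b (db t)) ->
  (forall t, 0 <= t -> 0 <= b t) ->
  (forall t, 0 <= t -> `|m t| <= t * b t - db t) ->
  (forall e w, 0 < e -> exists2 t, w <= t & `|normal_pdf 0 1 t * f t| <= e) ->
  forall w, 0 <= w -> `|f w| <= b w.
Proof.
move=> fE bE b0 mb f0.
have half s : (s = 1 \/ s = -1) -> forall w, 0 <= w -> s * f w <= b w.
  move=> s1 w w0; rewrite leNgt; apply/negP => bf.
  pose F t : R := normal_pdf 0 1 t * (s * f t - b t).
  have FE t : 0 <= t ->
      is_derive t 1 F (normal_pdf 0 1 t * (s * m t + t * b t - db t)).
    move=> t0; have ? := bE _ t0; have ? := fE t; have ? := gaussian_derive t.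
    by apply: is_derive_eq; rewrite /GRing.scale/=; ring.
  have Fw : 0 < F w by rewrite /F mulr_gt0 ?gaussian_gt0// subr_gt0.
  (* Since [b >= 0], this [t] has [F t <= F w / 2], while [F] does not decrease from [w] to [t] and
     [F w > 0]: a contradiction. *)
  have [t wt ft] := f0 (F w / 2) w (divr_gt0 Fw (ltr0n _ 2)).
  have [|c /andP[wc ct]] := is_derive_MVT wt (f := F)
      (df := fun t => normal_pdf 0 1 t * (s * m t + t * b t - db t)).
    by move=> c /andP[wc ct]; apply: FE; exact: le_trans wc.
  have sm : `|s * m c| = `|m c| by case: s1 => ->; rewrite ?mulN1r ?normrN ?mul1r.
  have : 0 <= normal_pdf 0 1 c * (s * m c + c * b c - db c) * (t - w).
    rewrite mulr_ge0 ?subr_ge0// mulr_ge0 ?(ltW (gaussian_gt0 _))//.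
    have := mb c (le_trans w0 wc); rewrite -sm; have := ler_norm (- (s * m c)).
    by rewrite normrN; lra.
  move=> /[swap] <-; rewrite subr_ge0.
  have : F t <= `|normal_pdf 0 1 t * f t|.
    have -> : `|normal_pdf 0 1 t * f t| = `|s * (normal_pdf 0 1 t * f t)|.
      by case: s1 => ->; rewrite ?mulN1r ?normrN ?mul1r.
    apply: le_trans (ler_norm _).
    have : 0 <= normal_pdf 0 1 t * b t.
      by rewrite mulr_ge0 ?b0 ?(ltW (gaussian_gt0 _))//; lra.
    rewrite /F; lra.
  lra.
move=> w w0; rewrite ler_norml; apply/andP; split.
  by have := half (-1) (or_intror erefl) w w0; lra.
by have := half 1 (or_introl erefl) w w0; lra.
Qed.

Lemma inv1D_derive (c t : R) : 0 <= t ->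
  is_derive t 1 (fun t => c / (1 + t)) (- c / (1 + t) ^+ 2).
Proof.
move=> t0; have t1 : 1 + t != 0 by rewrite gt_eqF//; lra.
have ? : is_derive t 1 (fun t : R => (1 + t)^-1) (- (1 + t) ^- 2).
  have D1 : is_derive t 1 (fun t : R => 1 + t) (0 + 1) by exact: is_deriveD.
  have := is_deriveV t1 D1; rewrite add0r => D2.
  by apply: is_derive_eq; rewrite /GRing.scale/=; ring.
by apply: is_derive_eq; rewrite /GRing.scale/=; ring.
Qed.

(** Barrier [2 M / (1 + t)]: the slack in the barrier inequality is [M (1 + t^2) / (1 + t)^2]. The
    decay in [w] is what keeps the term [t f] of the equation bounded. *)
Lemma stein_decay f m M :
  (forall t, is_derive t 1 f (t * f t + m t)) -> (forall t, `|m t| <= M) ->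
  (forall e w, 0 < e -> exists2 t, w <= t & `|normal_pdf 0 1 t * f t| <= e) ->
  forall w, 0 <= w -> `|f w| <= 2 * M / (1 + w).
Proof.
move=> fE mM f0.
have M0 : 0 <= M by apply: le_trans (mM 0).
apply: (stein_barrier fE (b := fun t => 2 * M / (1 + t))
  (db := fun t => - (2 * M) / (1 + t) ^+ 2)) => // t t0.
- exact: inv1D_derive.
- by rewrite divr_ge0 ?mulr_ge0//; lra.
- apply: le_trans (mM t) _; rewrite mulNr opprK mulrA.
  have t1 : 0 < 1 + t by lra.
  rewrite -subr_ge0.
  have -> : t * (2 * M) / (1 + t) + 2 * M / (1 + t) ^+ 2 - M =
     M * (1 + t ^+ 2) / (1 + t) ^+ 2.
    by field; rewrite gt_eqF.
  rewrite divr_ge0 ?exprn_ge0 ?(ltW t1)// mulr_ge0//.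
  by have := sqr_ge0 t; lra.
Qed.

(** The constant [1] of the barrier [1 + 2 K / (1 + t)] absorbs the growth [|t|] of the right-hand
    side exactly, and the second term absorbs [K] as in [stein_decay]. This bounds [g] itself, whose
    right-hand side [phi - c] grows linearly. *)
Lemma stein_linear f m K :
  (forall t, is_derive t 1 f (t * f t + m t)) ->
  (forall t, `|m t| <= `|t| + K) ->
  (forall e w, 0 < e -> exists2 t, w <= t & `|normal_pdf 0 1 t * f t| <= e) ->
  forall w, 0 <= w -> `|f w| <= 1 + 2 * K.
Proof.
move=> fE mK f0 w w0.
have K0 : 0 <= K by have := mK 0; rewrite normr0 add0r; apply: le_trans.
have b0 t : 0 <= t -> 0 <= 2 * K / (1 + t).
  by move=> t0; rewrite divr_ge0 ?mulr_ge0//; lra.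
have := stein_barrier fE (b := fun t => 1 + 2 * K / (1 + t))
  (db := fun t => - (2 * K) / (1 + t) ^+ 2) _ _ _ f0 w0.
have -> : 1 + 2 * K / (1 + w) = 1 + 2 * K - 2 * K * w / (1 + w).
  by field; rewrite gt_eqF//; lra.
have : 0 <= 2 * K * w / (1 + w) by rewrite divr_ge0 ?mulr_ge0//; lra.
move=> Kw H; suff: `|f w| <= 1 + 2 * K - 2 * K * w / (1 + w) by lra.
apply: H => t t0.
- have D := inv1D_derive (2 * K) t0.
  have D1 : is_derive t 1 (cst 1 + (fun t => 2 * K / (1 + t)) : R -> R) (0 + - (2 * K) / (1 + t) ^+ 2) by exact: is_deriveD.
  by rewrite -[X in is_derive _ _ _ X]add0r.
- by have := b0 t t0; lra.
- apply: le_trans (mK t) _; rewrite ger0_norm// mulrDr mulr1 -addrA lerD2l.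
  have t1 : 0 < 1 + t by lra.
  rewrite mulNr opprK mulrA -subr_ge0.
  have -> : t * (2 * K) / (1 + t) + 2 * K / (1 + t) ^+ 2 - K =
     K * (1 + t ^+ 2) / (1 + t) ^+ 2.
    by field; rewrite gt_eqF.
  rewrite divr_ge0 ?exprn_ge0 ?(ltW t1)// mulr_ge0//.
  by have := sqr_ge0 t; lra.
Qed.
End SteinEquation.

Section SteinSolution.
Context {R : realType}.
Implicit Types (f m g phi : R -> R) (t w c K e h u s v : R).

(** The equation keeps its form under [t -> - t], so bounds on the half-line [w >= 0] carry over to
    the negative one. *)
Lemma stein_reflect f m :
  (forall t, is_derive t 1 f (t * f t + m t)) ->
  forall t, is_derive t 1 (f \o -%R) (t * f (- t) + - m (- t)).
Proof.
move=> fE t; have ? := fE (- t).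
by apply: is_derive_eq; rewrite /GRing.scale/=; ring.
Qed.

Lemma gaussianN t : normal_pdf 0 1 (- t) = normal_pdf 0 1 t :> R.
Proof. by rewrite !normal_pdfE ?oner_eq0// /normal_fun !subr0 sqrrN. Qed.

Lemma gaussian_vanish e w : 0 < e ->
  exists2 t, w <= t & normal_pdf 0 1 t <= e :> R.
Proof.
move=> e0; set k := @normal_peak R 1.
have k0 : 0 < k by rewrite normal_peak_gt0 ?oner_eq0.
have d0 : 0 <= 2 * k / e by rewrite divr_ge0 ?mulr_ge0 ?(ltW k0) ?(ltW e0).
(* Large enough that [k <= e t / 2], while [exp (t^2 / 2) >= t / 2]. *)
pose t := `|w| + 1 + 2 * k / e; have wt := ler_norm w; have w0 := normr_ge0 w.
have t1 : 1 <= t by rewrite /t; lra.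
exists t; first by rewrite /t; lra.
rewrite normal_pdfE ?oner_eq0// /normal_fun subr0 expr1n mulr2n -/k.
have -> : - t ^+ 2 / (1 + 1) = - (t ^+ 2 / 2) :> R by field.
rewrite expRN -[_ / _]/(k / _) ler_pdivrMr ?expR_gt0//.
have := expR_ge1Dx (t ^+ 2 / 2).
have tt : t <= t ^+ 2 by rewrite expr2 ler_peMr//; lra.
have ke : 2 * k <= e * t.
  have -> : 2 * k = e * (2 * k / e) by field; rewrite gt_eqF.
  by rewrite ler_pM2l// /t; lra.
move=> ex; have : e * (t / 2) <= e * expR (t ^+ 2 / 2) by rewrite ler_pM2l//; lra.
lra.
Qed.

(** The Gaussian density kills a bounded solution at infinity, whatever the size of the bound [B];
    this is the vanishing needed on both half-lines. *)
Lemma stein_decay_sym f m M :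
  (forall t, is_derive t 1 f (t * f t + m t)) -> (forall t, `|m t| <= M) ->
  (exists B, forall t, `|f t| <= B) ->
  forall w, `|f w| <= 2 * M / (1 + `|w|).
Proof.
move=> fE mM [B fB] w.
have van g : (forall t, `|g t| <= B) -> forall e w, 0 < e ->
    exists2 t, w <= t & `|normal_pdf 0 1 t * g t| <= e.
  move=> gB e v e0.
  have B0 : 0 <= B by apply: le_trans (fB 0).
  have B1 : 0 < B + 1 by lra.
  have [t vt te] := gaussian_vanish v (divr_gt0 e0 B1).
  exists t => //; rewrite normrM gtr0_norm ?gaussian_gt0//.
  rewrite ler_pdivlMr// in te; apply: le_trans te.
  rewrite ler_pM2l ?gaussian_gt0//; have := gB t; lra.
case: (leP 0 w) => w0.
  by rewrite (ger0_norm w0); apply: (stein_decay fE mM) => //; exact: van.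
rewrite (ltr0_norm w0) -[w in f w]opprK.
apply: (stein_decay (f := f \o -%R) (m := fun t => - m (- t))) => //=.
- exact: stein_reflect.
- by move=> t; rewrite normrN.
- by apply: van => t; exact: fB.
- by rewrite oppr_ge0 ltW.
Qed.

(* The difference quotients of [g] solve the same equation with the bounded
   right-hand side [g (t + h) + (phi (t + h) - phi t) / h], so they satisfy a
   bound uniform in [h]; no derivative of [phi] is ever taken. *)
Lemma stein_solution_bounds phi c K g :
  (forall a b, `|phi a - phi b| <= `|a - b|) -> `|phi 0 - c| <= K ->
  (forall t, is_derive t 1 g (t * g t + (phi t - c))) ->
  (forall e, 0 < e -> exists w, forall t, w <= `|t| ->
    `|normal_pdf 0 1 t * g t| <= e) ->
  (forall t, `|t * g t + (phi t - c)| <= 10 * (1 + K)) /\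
  (forall s t, `|(s * g s + (phi s - c)) - (t * g t + (phi t - c))| <=
     10 * (1 + K) * `|s - t|).
Proof.
move=> lip phi0 gE g0.
have K0 : 0 <= K by apply: le_trans phi0.
pose dg t := t * g t + (phi t - c).
have kK t : `|phi t - c| <= `|t| + K.
  have -> : phi t - c = (phi t - phi 0) + (phi 0 - c) by ring.
  apply: le_trans (ler_normD _ _) (lerD _ phi0).
  by apply: le_trans (lip _ _) _; rewrite subr0.
have van (e w : R) : 0 < e -> exists2 t, w <= t & `|normal_pdf 0 1 t * g t| <= e.
  move=> /g0[v vP]; exists (`|v| + `|w|).
    by have := ler_norm w; have := normr_ge0 v; lra.
  apply: vP; apply: le_trans (ler_norm _); have := ler_norm v.
  by have := normr_ge0 w; lra.
have vanN (e w : R) : 0 < e -> exists2 t, w <= t & `|normal_pdf 0 1 t * g (- t)| <= e.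
  move=> /g0[v vP]; exists (`|v| + `|w|).
    by have := ler_norm w; have := normr_ge0 v; lra.
  rewrite -[X in X * _]gaussianN.
  apply: vP; rewrite normrN; apply: le_trans (ler_norm _); have := ler_norm v.
  by have := normr_ge0 w; lra.
have gB t : `|g t| <= 1 + 2 * K.
  case: (leP 0 t) => t0; first exact: (stein_linear gE kK).
  rewrite -[t]opprK.
  apply: (stein_linear (f := g \o -%R) (m := fun t => - (phi (- t) - c))) => //=.
  - exact: (stein_reflect gE).
  - by move=> u; rewrite normrN; have := kK (- u); rewrite [X in _ <= X + _]normrN.
  - by rewrite oppr_ge0 ltW.
(* [M] bounds the new right-hand side: [1 + 2 K] from [g (t + h)] and [1] from the Lipschitz
   quotient of [phi]. *)
pose M := 2 + 2 * K.
have M0 : 0 <= M by rewrite /M; lra.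
have dgL (h t : R) : 0 < h -> `|dg (t + h) - dg t| <= 3 * M * h.
  move=> h0.
  pose f t := (g (t + h) - g t) / h.
  pose m t := g (t + h) + (phi (t + h) - phi t) / h.
  have fE (u : R) : is_derive u 1 f (u * f u + m u).
    have ? := gE u; have ? := gE (u + h).
    have D : is_derive u 1 (fun u => u + h) 1.
      by apply: is_derive_eq; rewrite addr0.
    have ? : is_derive u 1 (g \o (fun u => u + h)) (dg (u + h)).
      by have := @is_derive1_comp _ g _ u _ _ (gE (u + h)) D; rewrite mulr1.
    apply: is_derive_eq; rewrite /GRing.scale/= /f /m /dg.
    by field; rewrite gt_eqF.
  have mM u : `|m u| <= M.
    apply: le_trans (ler_normD _ _) _.
    have : `|(phi (u + h) - phi u) / h| <= 1.
      rewrite normrM normfV (gtr0_norm h0) ler_pdivrMr// mul1r.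
      by apply: le_trans (lip _ _) _; rewrite addrAC subrr add0r gtr0_norm.
    by have := gB (u + h); rewrite /M; lra.
  (* This bound blows up as [h] tends to [0], but only its existence is used; the decay obtained
     from it is uniform in [h]. *)
  have fB : exists B, forall t, `|f t| <= B.
    exists ((2 + 4 * K) / h) => u.
    rewrite normrM normfV (gtr0_norm h0) ler_pM2r ?invr_gt0//.
    apply: le_trans (ler_normB _ _) _.
    by have := gB (u + h); have := gB u; lra.
  have := stein_decay_sym fE mM fB t; set q := `|f t| => fq.
  have t1 : 0 < 1 + `|t| by have := normr_ge0 t; lra.
  have -> : dg (t + h) - dg t = h * (t * f t + m t).
    by rewrite /dg /f /m; field; rewrite gt_eqF.
  rewrite normrM (gtr0_norm h0) mulrC ler_pM2r//.
  apply: le_trans (ler_normD _ _) _; rewrite normrM -/q.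
  suff : `|t| * q <= 2 * M by have := mM t; lra.
  move: fq; rewrite ler_pdivlMr// => fq.
  apply: le_trans fq; rewrite mulrDr mulr1 mulrC lerDr; exact: normr_ge0.
have dgL' s t : `|dg s - dg t| <= 3 * M * `|s - t|.
  wlog st : s t / t <= s => [wl|].
    have [/wl//|/ltW/wl] := leP t s.
    by rewrite distrC [X in _ -> _ <= _ * X]distrC.
  move: st; rewrite le_eqVlt => /orP[/eqP ->|st].
    by rewrite !subrr normr0 mulr0.
  have {1}-> : s = t + (s - t) by ring.
  by rewrite [X in _ <= _ * X]gtr0_norm ?subr_gt0//; apply: dgL; rewrite subr_gt0.
split=> [t|s t].
  (* On [[t, t + 1]] the derivative takes the value [g (t + 1) - g t], at most [2 + 4 K]; moving to
     [t] costs at most [3 M = 6 + 6 K], and the total is below [10 (1 + K)]. *)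
  have t1 : t <= t + 1 by lra.
  have [c' /andP[tc ct] E] := is_derive_MVT t1 (fun u _ => gE u).
  have E' : dg c' = g (t + 1) - g t by rewrite E /dg; ring.
  have := ler_normB (g (t + 1)) (g t); rewrite -E'.
  have := gB (t + 1); have := gB t.
  have := dgL' t c'; have := ler_normD (dg t - dg c') (dg c').
  rewrite subrK.
  have tc1 : `|t - c'| <= 1 by rewrite ler_norml; lra.
  have : 3 * M * `|t - c'| <= 3 * M * 1 by rewrite ler_wpM2l//; lra.
  by rewrite -/(dg t) /M; lra.
apply: le_trans (dgL' s t) _; rewrite ler_wpM2r// /M; lra.
Qed.

End SteinSolution.

(** * Integrals against the standard Gaussian law *)

Section GaussianIntegral.
Context {R : realType}.
Local Notation mu := (@lebesgue_measure R).
Local Notation pdf := (@normal_pdf R 0 1).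
Local Notation gam := (@normal_prob R 0 1).
Implicit Types (phi : R -> R).

Lemma continuous_pdf : continuous pdf.
Proof. by apply: continuous_normal_pdf; rewrite oner_eq0. Qed.

Lemma lipschitz_continuous phi :
  (forall a b, `|phi a - phi b| <= `|a - b|) -> continuous phi.
Proof.
move=> lip x; apply/cvgrPdist_le => e e0; near=> y.
apply: le_trans (lip _ _) _; near: y.
exact: (@cvgr_dist_le _ _ _ _ _ id x cvg_id).
Unshelve. all: by end_near. Qed.

(** The density and the Radon-Nikodym derivative have the same integral over every measurable set,
    hence agree almost everywhere. *)
Lemma ge0_integral_normal_prob (f : R -> \bar R) : (forall t, (0 <= f t)%E) ->
  measurable_fun [set: R] f ->
  (\int[gam]_t f t = \int[mu]_t (f t * (pdf t)%:E))%E.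
Proof.
move=> f0 mf; have dom := @normal_prob_dominates R 0 1.
rewrite -(Radon_Nikodym_SigmaFinite.change_of_variables dom)//.
have intRN := Radon_Nikodym_SigmaFinite.f_integrable dom.
have mpdf : measurable_fun [set: R] (EFin \o pdf).
  by apply/measurable_EFinP; exact: measurable_normal_pdf.
apply: ae_eq_integral => //.
- by apply: emeasurable_funM => //; exact: measurable_int intRN.
- exact: emeasurable_funM.
apply: ae_eqe_mul2l; apply: integral_ae_eq => // E _ mE.
by rewrite -(Radon_Nikodym_SigmaFinite.f_integral dom).
Qed.

Lemma integrable_normal_prob phi : measurable_fun [set: R] phi ->
  mu.-integrable setT (fun t => (phi t * pdf t)%:E) ->
  gam.-integrable setT (EFin \o phi) /\
  (\int[gam]_t (phi t)%:E = \int[mu]_t (phi t * pdf t)%:E)%E.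
Proof.
move=> mphi int.
have mE : measurable_fun [set: R] (EFin \o phi) by exact/measurable_EFinP.
have intg : gam.-integrable setT (EFin \o phi).
  apply/integrableP; split => //.
  rewrite ge0_integral_normal_prob//; last by exact: measurableT_comp.
  move/integrableP : int => [_]; apply: le_lt_trans.
  apply: ge0_le_integral => //=.
  - by move=> t _; rewrite lee_fin mulr_ge0// normal_pdf_ge0.
  - apply/measurable_EFinP/measurable_funM; last exact: measurable_normal_pdf.
    exact: measurableT_comp.
  - apply/measurable_EFinP; apply: measurableT_comp => //.
    by apply: measurable_funM => //; exact: measurable_normal_pdf.
  - by move=> t _; rewrite lee_fin normrM (ger0_norm (normal_pdf_ge0 _ _ _)).
split=> //.
rewrite integralE [RHS]integralE; congr (_ - _)%E.
- rewrite ge0_integral_normal_prob//; last exact: measurable_funepos.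
  apply: eq_integral => t _; rewrite !funeposE /= -!EFin_max -EFinM.
  by rewrite maxr_pMl ?mul0r// normal_pdf_ge0.
- rewrite ge0_integral_normal_prob//; last exact: measurable_funeneg.
  apply: eq_integral => t _; rewrite !funenegE /= -!EFin_max -EFinM.
  by rewrite maxr_pMl ?mul0r ?mulNr// normal_pdf_ge0.
Qed.

(* [(1 + t^2) exp(- t^2 / 2) <= 4 exp(- t^2 / 4)], a multiple of the Gaussian
   density of variance [2]. *)
Lemma integrable_second_moment : mu.-integrable setT
  (fun t : R => ((1 + t ^+ 2) * pdf t)%:E).
Proof.
pose s := Num.sqrt 2 : R.
have s0 : s != 0 by rewrite gt_eqF// sqrtr_gt0.
pose k := @normal_peak R 1 * 4 / normal_peak s.
have int : mu.-integrable setT (fun t => k%:E * (normal_pdf 0 s t)%:E)%E.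
  by apply: integrableZl => //; exact: integrable_normal_pdf.
apply: le_integrable int => //.
  apply/measurable_EFinP/measurable_funM; last exact: measurable_normal_pdf.
  by apply: measurable_funD => //; exact: measurable_funX.
move=> t _; rewrite -EFinM /= lee_fin ger0_norm; last first.
  by rewrite mulr_ge0 ?normal_pdf_ge0// addr_ge0// sqr_ge0.
apply: le_trans (ler_norm _).
rewrite !normal_pdfE ?oner_eq0// /normal_fun !subr0 sqr_sqrtr// expr1n.
set p := normal_peak 1; set q := normal_peak s.
have p0 : 0 < p by rewrite normal_peak_gt0 ?oner_eq0.
have q0 : 0 < q by rewrite normal_peak_gt0.
have -> : k * (q * expR (- t ^+ 2 / (2 *+ 2))) = p * (4 * expR (- t ^+ 2 / (2 *+ 2))).
  by rewrite /k -/p -/q; field; rewrite gt_eqF.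
rewrite mulrCA ler_pM2l//.
have -> : - t ^+ 2 / (1 *+ 2) = - (t ^+ 2 / 4) + - t ^+ 2 / (2 *+ 2).
  by rewrite !mulr2n; field.
rewrite expRD mulrA ler_pM2r ?expR_gt0// expRN ler_pdivrMr ?expR_gt0//.
by have := expR_ge1Dx (t ^+ 2 / 4); lra.
Qed.
End GaussianIntegral.

(** * Existence of a Stein solution with uniform bounds *)

Section SteinExistence.
Context {R : realType}.
Local Notation mu := (@lebesgue_measure R).
Local Notation pdf := (@normal_pdf R 0 1).
Local Notation gam := (@normal_prob R 0 1).
Implicit Types (phi : R -> R).

Lemma measurable_lipschitz phi :
  (forall a b, `|phi a - phi b| <= `|a - b|) -> measurable_fun [set: R] phi.
Proof.
by move=> lip; apply: continuous_measurable_fun; exact: lipschitz_continuous.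
Qed.

Lemma integrable_lipschitz phi (c : R) :
  (forall a b, `|phi a - phi b| <= `|a - b|) ->
  mu.-integrable setT (fun t => ((phi t - c) * pdf t)%:E).
Proof.
move=> lip; pose k := 1 + `|phi 0 - c|.
have int : mu.-integrable setT
    (fun t => k%:E * ((1 + t ^+ 2) * pdf t)%:E)%E.
  by apply: integrableZl => //; exact: integrable_second_moment.
apply: le_integrable int => //.
  apply/measurable_EFinP/measurable_funM; last exact: measurable_normal_pdf.
  by apply: measurable_funB => //; exact: measurable_lipschitz.
move=> t _; rewrite -EFinM /= lee_fin.
have p0 := normal_pdf_ge0 0 1 t; have t2 := sqr_ge0 t.
rewrite normrM (ger0_norm p0) [X in _ <= X]ger0_norm; last first.
  by apply: mulr_ge0; [exact: addr_ge0|apply: mulr_ge0 => //; exact: addr_ge0].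
rewrite mulrA ler_wpM2r//.
have -> : phi t - c = (phi t - phi 0) + (phi 0 - c) by ring.
apply: le_trans (ler_normD _ _) _.
have := lip t 0; rewrite subr0 => tt.
have : 0 <= (`|t| - 1) ^+ 2 by exact: sqr_ge0.
have : 0 <= `|phi 0 - c| * t ^+ 2 by rewrite mulr_ge0.
have := real_normK (num_real t); rewrite /k; nra.
Qed.

Lemma expectation_gaussian d (T : measurableType d) (Q : probability T R)
    (Z : {RV Q >-> R}) phi : is_standard_gaussian Z ->
  (forall a b, `|phi a - phi b| <= `|a - b|) ->
  ('E_Q[(fun w => phi (Z w))] = (\int[mu]_t (phi t * pdf t))%:E)%E.
Proof.
move=> gZ lip; have mphi := measurable_lipschitz lip.
have := integrable_lipschitz 0 lip; under eq_fun do rewrite subr0.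
move=> int; have [intg Eg] := integrable_normal_prob mphi int.
have mZ : measurable_fun setT (Z : T -> measurableTypeR R).
  by move=> mT A mA; apply: (measurable_funP Z).
pose Z' : {mfun T >-> measurableTypeR R} :=
  MeasurableFun.Pack (MeasurableFun.Class (isMeasurableFun.Build _ _ _ _ _ mZ)).
have QZ (f : R -> \bar R) :
    (\int[distribution Q Z']_t f t = \int[gam]_t f t)%E.
  by apply: (@eq_measure_integral _ _ R setT gam (distribution Q Z') f) => A mA _;
    exact: gZ.
have mE : measurable_fun (setT : set (measurableTypeR R)) (EFin \o phi).
  by apply/measurable_EFinP.
rewrite unlock -(@integral_distribution _ _ _ _ _ Q Z' (EFin \o phi))//.
  rewrite QZ Eg /Rintegral fineK//.
  by apply: integrable_fin_num.
apply/integrableP; split; first exact: measurableT_comp.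
move/integrableP : intg => [_]; rewrite -QZ ge0_integral_distribution//.
exact: measurableT_comp.
Qed.

(** Markov's inequality: on [D] the factor [v] is at most [|t|], and
    [|t| (|t| + A) <= (1 + A) (1 + t^2)]. It gives the decay [1/|w|] of the tail integrals, hence
    the vanishing of [pdf g] at infinity. *)
Lemma gaussian_tail phi (c A : R) (D : set R) (v : R) :
  (forall a b, `|phi a - phi b| <= `|a - b|) ->
  `|phi 0 - c| <= A -> measurable (D : set (measurableTypeR R)) -> 0 <= v ->
  (forall t, D t -> v <= `|t|) ->
  v * `|\int[mu]_(t in D) ((phi t - c) * pdf t)| <=
    (1 + A) * \int[mu]_t ((1 + t ^+ 2) * pdf t).
Proof.
move=> lip cA mD v0 vD.
have A0 : 0 <= A by apply: le_trans cA.
have int := integrable_lipschitz c lip.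
have intD : mu.-integrable D (EFin \o (fun t => (phi t - c) * pdf t)).
  exact: integrableS int.
have int2 : mu.-integrable setT (EFin \o (fun t => (1 + t ^+ 2) * pdf t)).
  exact: integrable_second_moment.
have int2D : mu.-integrable D (EFin \o (fun t => (1 + t ^+ 2) * pdf t)).
  exact: integrableS int2.
apply: (@le_trans _ _ (v * \int[mu]_(t in D) `|(phi t - c) * pdf t|)).
  by rewrite ler_wpM2l// le_normr_Rintegral.
have intN : mu.-integrable D (EFin \o (fun t => `|(phi t - c) * pdf t|)).
  exact: integrable_norm.
rewrite -RintegralZl//.
apply: (@le_trans _ _ (\int[mu]_(t in D) ((1 + A) * ((1 + t ^+ 2) * pdf t)))).
  apply: le_Rintegral => //.
  - by have := integrableZl mD v intN; apply: eq_integrable.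
  - by have := integrableZl mD (1 + A) int2D; apply: eq_integrable.
  - move=> t Dt; have p0 := normal_pdf_ge0 0 1 t.
    rewrite normrM (ger0_norm p0) !mulrA ler_wpM2r//.
    have tt : `|phi t - c| <= `|t| + A.
      have -> : phi t - c = (phi t - phi 0) + (phi 0 - c) by ring.
      apply: le_trans (ler_normD _ _) (lerD _ cA).
      by have := lip t 0; rewrite subr0.
    apply: (@le_trans _ _ (`|t| * (`|t| + A))).
      by apply: ler_pM => //; exact: vD.
    have : 0 <= A * (`|t| - 1) ^+ 2 by rewrite mulr_ge0// sqr_ge0.
    have : 0 <= A * t ^+ 2 by rewrite mulr_ge0// sqr_ge0.
    have := real_normK (num_real t); nra.
rewrite RintegralZl// ler_wpM2l ?addr_ge0// /Rintegral.
apply: fine_le; [exact: integrable_fin_num int2D|exact: integrable_fin_num int2|].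
apply: ge0_subset_integral => //.
- exact: measurable_int int2.
- by move=> t _; rewrite lee_fin mulr_ge0 ?normal_pdf_ge0// addr_ge0// sqr_ge0.
Qed.

(** [pdf] is an integrating factor: the equation reads [(pdf g)' = pdf (phi - c)], so [g] is the
    primitive from minus infinity divided by [pdf]. The constant depends only on the Gaussian
    integral of [1 + t^2], not on [phi]. *)
Theorem stein_solution : exists2 C : R, 0 <= C &
  forall phi d (T : measurableType d) (Q : probability T R) (Z : {RV Q >-> R}),
  is_standard_gaussian Z -> (forall a b, `|phi a - phi b| <= `|a - b|) ->
  exists c (g dg : R -> R), [/\ ('E_Q[(fun w => phi (Z w))] = c%:E)%E,
    forall t : R, is_derive t 1 g (dg t),
    forall t, dg t - t * g t = phi t - c,
    forall t, `|dg t| <= C &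
    forall s t, `|dg s - dg t| <= C * `|s - t| ].
Proof.
pose A := \int[mu]_t ((1 + t ^+ 2) * pdf t).
have A0 : 0 <= A.
  apply: Rintegral_ge0 => t _; rewrite mulr_ge0 ?normal_pdf_ge0//.
  by rewrite addr_ge0// sqr_ge0.
exists (10 * (1 + A)); first by rewrite mulr_ge0// addr_ge0.
move=> phi d T Q Z gZ lip.
pose c := \int[mu]_t (phi t * pdf t).
pose k t := (phi t - c) * pdf t.
have int := integrable_lipschitz c lip.
have intp : mu.-integrable setT (EFin \o pdf) by exact: integrable_normal_pdf.
have intphi : mu.-integrable setT (EFin \o (fun t => phi t * pdf t)).
  by have := integrable_lipschitz 0 lip; under eq_fun do rewrite subr0.
have pdf1 : \int[mu]_t pdf t = 1 by rewrite /Rintegral integral_normal_pdf.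
have centered a : \int[mu]_t ((phi t - a) * pdf t) = c - a.
  have intap : mu.-integrable setT (EFin \o (fun t => a * pdf t)).
    by have := integrableZl measurableT a intp; apply: eq_integrable.
  under eq_Rintegral do rewrite mulrBl.
  by rewrite RintegralB// RintegralZl// pdf1 mulr1.
have cA : `|phi 0 - c| <= A.
  rewrite distrC -centered.
  have int0 := integrable_lipschitz (phi 0) lip.
  apply: le_trans (le_normr_Rintegral measurableT int0) _.
  apply: le_Rintegral => //.
  - exact: integrable_norm.
  - exact: integrable_second_moment.
  - move=> t _; rewrite normrM (ger0_norm (normal_pdf_ge0 0 1 t)).
    rewrite ler_wpM2r ?normal_pdf_ge0//.
    apply: le_trans (lip t 0) _; rewrite subr0.
    have : 0 <= (`|t| - 1) ^+ 2 by exact: sqr_ge0.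
    have := real_normK (num_real t); nra.
pose G w := \int[mu]_(t in `]-oo, w]) k t.
have ck : continuous k.
  move=> x; apply: cvgM; last exact: continuous_pdf.
  apply: (@cvgB _ R^o); last exact: cvg_cst.
  exact: lipschitz_continuous.
have GE (w : R) : is_derive w 1 G (k w).
  have ww : w < w + 1 by lra.
  have kint : mu.-integrable [set` `]-oo, (w + 1)%R]] (EFin \o k).
    by apply: integrableS int.
  have [D E] := continuous_FTC1 ww kint (ltNyr w) (ck w).
  by split => //; rewrite -E derive1E.
have G0 (w : R) : `|w| * `|G w| <= (1 + A) * A.
  have [w0|w0] := leP w 0.
    apply: gaussian_tail => // t /=; rewrite in_itv/= => tw.
    by rewrite ler0_norm// ler0_norm ?lerN2// (le_trans tw).
  (* For [w > 0] the left integral is not small by itself; as [(phi - c) pdf] has total integral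
     [0], it equals minus the right tail. *)
  have -> : G w = - \int[mu]_(t in `]w, +oo[) k t.
    rewrite -(@Rintegral_itvB _ k -oo%O +oo%O w)//.
    - by rewrite set_itvNyy centered subrr sub0r opprK.
    - by rewrite set_itvNyy; exact: int.
  rewrite normrN; apply: gaussian_tail => // t /=; rewrite in_itv/= andbT => tw.
  by rewrite gtr0_norm// gtr0_norm ?(lt_trans w0)// ltW.
pose g t := G t / pdf t.
have p0 t : pdf t != 0 by rewrite gt_eqF// gaussian_gt0.
have gE (t : R) : is_derive t 1 g (t * g t + (phi t - c)).
  have ? := GE t; have D1 := is_deriveV (p0 t) (gaussian_derive t).
  by apply: is_derive_eq; rewrite /GRing.scale/= /g /k; field.
have [] := stein_solution_bounds lip cA gE.
  move=> e e0; exists ((1 + A) * A / e + 1) => t te.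
  rewrite /g mulrC divfK//.
  have B0 : 0 <= (1 + A) * A by rewrite mulr_ge0// addr_ge0.
  have t0 : 0 < `|t| by apply: lt_le_trans te; rewrite ltr_wpDl// divr_ge0// ltW.
  rewrite -(ler_pM2l t0); apply: le_trans (G0 t) _.
  rewrite -ler_pdivrMr//; apply: le_trans te; lra.
move=> B1 B2; exists c, g, (fun t => t * g t + (phi t - c)); split => //.
- exact: expectation_gaussian.
- by move=> t; ring.
Qed.

End SteinExistence.

(** * Reduction to independent signs *)

Section FiniteExpectation.
Context {R : realType} d (T : measurableType d) (P : probability T R).

(** The events [E s] may fail to cover [T]: being disjoint, of equal probability [q] and [#|Om|] in
    number, they have total mass [1], so what lies outside is null. *)
Lemma expectation_partition (Om : finType) (E : Om -> set T) (f : T -> R)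
    (F : Om -> R) (q : R) :
  measurable_fun setT f -> (forall s, measurable (E s)) ->
  (forall s t w, E s w -> E t w -> s = t) ->
  (forall s, P (E s) = q%:E) -> q * #|Om|%:R = 1 ->
  (forall s w, E s w -> f w = F s) ->
  ('E_P[f] = (q * \sum_s F s)%:E)%E.
Proof.
move=> mf mE dE PE q1 fF.
pose D := \big[setU/set0]_(s <- enum Om) E s.
have mD : measurable D by apply: bigsetU_measurable.
have tE : trivIset [set` enum Om] E.
  by apply/trivIsetP => s t _ _ st; rewrite -subset0 => w [/dE sw /sw /eqP];
    rewrite (negbTE st).
have mEf A : measurable_fun A (EFin \o f).
  by apply/measurable_EFinP; apply: measurable_funTS.
have int1 A : measurable A -> (\int[P]_(x in A) (cst 1%R x)%:E = P A)%E.
  by move=> mA; rewrite -[RHS]mul1e -integral_cst.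
have PD : P D = 1%E.
  rewrite -int1// /D integral_bigsetU_EFin ?enum_uniq//;
    last exact/measurable_EFinP.
  transitivity (\sum_(s <- enum Om) q%:E)%E.
    by apply: eq_bigr => s _; rewrite int1 ?PE.
  by rewrite sumEFin big_enum /= sumr_const -mulr_natr q1.
have PDC : P (~` D) = 0%E by rewrite probability_setC// PD subee.
rewrite unlock -(setUv D) integral_setU//.
- rewrite [X in (_ + X)%E]null_set_integral ?adde0//; last exact: measurableC.
  rewrite integral_bigsetU_EFin ?enum_uniq//.
  transitivity (\sum_(s <- enum Om) (F s * q)%:E)%E.
    apply: eq_bigr => s _; rewrite EFinM -(PE s) -integral_cst//.
    by apply: eq_integral => w; rewrite inE => /fF ->.
  by rewrite sumEFin big_enum /= -mulr_suml mulrC.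
- exact: measurableC.
- by apply/disj_setPCl.
Qed.

End FiniteExpectation.

Section SignVectors.
Context {R : realType}.

(** Finite index set of the signs: a prime at least [K] divides no positive integer below [K]. *)
Definition prime_below (K : nat) : finType := {p : 'I_K | prime p}.

Definition sign_mean (I : finType) (F : {ffun I -> bool} -> R) : R :=
  (2 ^- #|I|) * \sum_s F s.

Lemma expectation_signs d (T : measurableType d) (P : probability T R)
    (X : nat -> {RV P >-> R}) (K : nat) (f : T -> R)
    (F : {ffun prime_below K -> bool} -> R) :
  mutually_independent [set p | prime p] X ->
  (forall p : nat, prime p ->
     P [set w | X p w = 1] = (1 / 2)%:E /\ P [set w | X p w = -1] = (1 / 2)%:E) ->
  measurable_fun setT f ->
  (forall (s : {ffun prime_below K -> bool}) w,
    (forall p : prime_below K, X (val (val p)) w = (-1) ^+ s p) ->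
     f w = F s) ->
  ('E_P[f] = (sign_mean F)%:E)%E.
Proof.
move=> indep half mf fF.
pose v (p : prime_below K) : nat := val (val p).
have vinj : injective v by apply: inj_comp val_inj val_inj.
pose E (s : {ffun prime_below K -> bool}) : set T :=
  \bigcap_(p in [set: prime_below K]) (X (v p) @^-1` [set (-1) ^+ s p]).
have mX (p : nat) (b : bool) : measurable (X p @^-1` [set (-1) ^+ b : R]).
  by rewrite -[_ @^-1` _]setTI; apply: (measurable_funP (X p)).
have vP (p : prime_below K) : prime (v p) by case: p.
apply: (expectation_partition (E := E)) => //.
- move=> s; rewrite /E; apply: fin_bigcap_measurable => //; exact: finite_finset.
- move=> s t w Es Et; apply/ffunP => p.
  have Xs : X (v p) w = (-1) ^+ s p := Es p I.
  have Xt : X (v p) w = (-1) ^+ t p := Et p I.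
  by apply: (@signr_inj R); rewrite -Xs.
- move=> s.
  (* Independence is stated for a family of events over all of [nat], so the sign vector is extended
     by [false] off the primes below [K]. *)
  pose ss (n : nat) : bool := [exists p, (v p == n) && s p].
  have ssv p : ss (v p) = s p.
    apply/existsP/idP => [[q /andP[/eqP/vinj ->]]//|sp].
    by exists p; rewrite eqxx.
  pose J : {fset nat} := [fset n in [seq v p | p <- enum (prime_below K)]]%fset.
  have JP : [set` J] `<=` [set p | prime p].
    by move=> n /=; rewrite !inE /= => /mapP[p _ ->]; exact: vP.
  have -> : E s = \bigcap_(n in [set` J]) (X n @^-1` [set (-1) ^+ ss n]).
    rewrite eqEsubset; split=> w Ew.
      move=> n /=; rewrite !inE /= => /mapP[p _ ->]; rewrite ssv; exact: Ew.
    move=> p _ /=; rewrite -ssv; apply: Ew => /=; rewrite !inE /=.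
    by apply: map_f; rewrite mem_enum.
  rewrite (indep J (fun n => [set ((-1) ^+ ss n : R)]))//.
  transitivity (\prod_(n <- J) (1 / 2 : R)%:E)%E.
    apply: eq_big_seq => n nJ; have /half[H1 H2] := JP n nJ.
    by case: (ss n); rewrite /= ?expr1 ?expr0.
  rewrite big_const_seq count_predT.
  have -> : size J = #|prime_below K|.
    have uJ : uniq [seq v p | p <- enum (prime_below K)].
      by rewrite map_inj_uniq ?enum_uniq.
    by rewrite -[size J]/(#|` J|) card_fseq undup_id// size_map -cardE.
  elim: #|prime_below K| => [|n IH]; first by rewrite /= expr0 invr1.
  by rewrite [LHS]/= IH -EFinM exprS invfM div1r.
- rewrite card_ffun card_bool natrX mulVf// expf_neq0//.
- by move=> s w Es; apply: fF => p; exact: Es.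
Qed.

End SignVectors.

(** * Walsh sums *)

Section SignMean.
Context {R : realType} {I : finType}.
Local Notation Om := {ffun I -> bool}.
Local Notation E := (@sign_mean R I).
Implicit Types (F G : Om -> R) (a b : I -> bool) (s : Om).

Lemma sign_meanD F G : E (fun s => F s + G s) = E F + E G.
Proof. by rewrite /sign_mean big_split/= mulrDr. Qed.

Lemma sign_meanZ (k : R) F : E (fun s => k * F s) = k * E F.
Proof. by rewrite /sign_mean -mulr_sumr mulrCA. Qed.

Lemma sign_mean_sum (K : finType) (P : pred K) (F : K -> Om -> R) :
  E (fun s => \sum_(k | P k) F k s) = \sum_(k | P k) E (F k).
Proof. by rewrite /sign_mean exchange_big/= mulr_sumr. Qed.

Lemma eq_sign_mean F G : F =1 G -> E F = E G.
Proof. by move=> FG; rewrite /sign_mean (eq_bigr G). Qed.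

Lemma ler_sign_mean F G : (forall s, F s <= G s) -> E F <= E G.
Proof.
by move=> FG; rewrite /sign_mean ler_wpM2l ?invr_ge0 ?exprn_ge0// ler_sum.
Qed.

Lemma sign_mean_cst (k : R) : E (fun=> k) = k.
Proof.
by rewrite /sign_mean sumr_const card_ffun card_bool -[k *+ _]mulr_natl natrX mulKf//.
Qed.

Lemma ler_norm_sign_mean F : `|E F| <= E (fun s => `|F s|).
Proof.
rewrite /sign_mean normrM ger0_norm ?invr_ge0 ?exprn_ge0//.
by rewrite ler_wpM2l ?invr_ge0 ?exprn_ge0// ler_norm_sum.
Qed.

(** Cauchy-Schwarz through [|F| <= F^2 / (2 r) + r / 2] with [r = sqrt V]. *)
Lemma sign_mean_norm_sqrt F (V : R) : 0 < V ->
  E (fun s => F s ^+ 2) <= V -> E (fun s => `|F s|) <= Num.sqrt V.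
Proof.
move=> V0 FV; have r0 : 0 < Num.sqrt V by rewrite sqrtr_gt0.
have rr : Num.sqrt V * Num.sqrt V = V by rewrite -expr2 sqr_sqrtr// ltW.
move: r0 rr; set r := Num.sqrt V => r0 rr.
apply: (@le_trans _ _ (E (fun s => (2 * r)^-1 * F s ^+ 2 + r / 2))).
  apply: ler_sign_mean => s; rewrite -subr_ge0.
  have -> : (2 * r)^-1 * F s ^+ 2 + r / 2 - `|F s| = (`|F s| - r) ^+ 2 / (2 * r).
    rewrite -(real_normK (num_real (F s))); field.
    by rewrite gt_eqF.
  by rewrite divr_ge0 ?sqr_ge0// mulr_ge0// ltW.
rewrite sign_meanD sign_meanZ sign_mean_cst.
have Vr : (2 * r)^-1 * V = r / 2 by rewrite -rr; field; rewrite gt_eqF.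
by rewrite [leRHS]splitr lerD2r -Vr ler_wpM2l// invr_ge0 mulr_ge0// ltW.
Qed.

Definition flip (i : I) s : Om := [ffun j => s j (+) (j == i)].

Lemma flipK i : involutive (flip i).
Proof. by move=> s; apply/ffunP => j; rewrite !ffunE addbK. Qed.

Lemma sign_mean_flip i F : E (F \o flip i) = E F.
Proof.
rewrite /sign_mean; congr (_ * _).
by rewrite [RHS](reindex_inj (inv_inj (flipK i))).
Qed.

(** Character of the sign group attached to a set of coordinates, given by its indicator so that
    products become pointwise xor. For the prime divisors of a squarefree [n] it is [X(n)]. *)
Definition walsh a s : R := \prod_i (-1) ^+ (a i && s i).

Lemma walshM a b s : walsh a s * walsh b s = walsh (fun i => a i (+) b i) s.
Proof.
rewrite /walsh -big_split/=; apply: eq_bigr => i _.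
by case: (a i) (b i) (s i) => -[] []; rewrite //= ?expr0 ?expr1 ?mul1r ?mulr1 ?mulrNN ?mul1r.
Qed.

Lemma walsh_sqr a s : walsh a s * walsh a s = 1.
Proof. by rewrite walshM /walsh big1// => i _; rewrite addbb. Qed.

Lemma walsh_flip a i s : walsh a (flip i s) = (-1) ^+ a i * walsh a s.
Proof.
rewrite /walsh (bigD1 i)//= [in RHS](bigD1 i)//= !ffunE eqxx.
rewrite (eq_bigr (fun j => (-1) ^+ (a j && s j))) => [|j /negbTE ji]; last first.
  by rewrite ffunE ji addbF.
rewrite mulrA; congr (_ * _).
by case: (a i) (s i) => -[]; rewrite //= ?expr0 ?expr1 ?mul1r ?mulr1 ?mulrNN ?mul1r.
Qed.

(** Flipping a coordinate in [a] negates the character, so its mean equals its own opposite. *)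
Lemma sign_mean_walsh a : E (walsh a) = [forall i, ~~ a i]%:R.
Proof.
case: (boolP [forall i, ~~ a i]) => [/forallP a0|/forallPn[i]]; last first.
  rewrite negbK => ai.
  have EN : - E (walsh a) = E (walsh a).
    rewrite -[in RHS](sign_mean_flip i) -mulN1r -sign_meanZ.
    by apply: eq_sign_mean => s /=; rewrite walsh_flip ai expr1.
  have /eqP : E (walsh a) *+ 2 = 0 by rewrite mulr2n -[X in X + _]EN addNr.
  by rewrite mulrn_eq0/= => /eqP.
rewrite -[RHS]sign_mean_cst; apply: eq_sign_mean => s.
by rewrite /walsh big1// => i _; rewrite (negbTE (a0 i)).
Qed.

End SignMean.

Section WalshSums.
Context {R : realType} {I J : finType}.
Variables (dv : J -> I -> bool) (top : J -> I) (GG : {set J}).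
Local Notation Om := {ffun I -> bool}.
Local Notation E := (@sign_mean R I).
Local Notation chi n := (@walsh R I (dv n)).
Implicit Types (s : Om) (n m : J) (i : I).

Definition wsum (H : {set J}) s : R := \sum_(n in H) chi n s.
Definition multiples i : {set J} := [set n in GG | dv n i].
Definition with_top i : {set J} := [set n in GG | top n == i].
(** Indices of the cross terms [X(n) X(m)] of [sum_p R_p U_p], the diagonal [n = m] being
    removed. *)
Definition related_pairs : {set J * J} :=
  [set u | [&& u.1 \in GG, u.2 \in GG, u.1 != u.2 & dv u.2 (top u.1)]].
(** For squarefree integers: the product of the four is a square. *)
Definition even4 (u v : J * J) : bool :=
  [forall i, ~~ (dv u.1 i (+) dv u.2 i (+) (dv v.1 i (+) dv v.2 i))].
(** Separating the first entry from the other three excludes every trivial solution: an equality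
    between any two entries forces the other two to agree. *)
Definition off_diagonal (H : {set J}) : {set (J * J) * (J * J)} :=
  [set q | [&& q.1.1 \in H, q.1.2 \in H, q.2.1 \in H & q.2.2 \in H] &&
    [&& even4 q.1 q.2, q.1.1 != q.1.2, q.1.1 != q.2.1 & q.1.1 != q.2.2]].

(** [S] is a free parameter because the count in the theorem includes the endpoint [x], which the
    sum omits. *)
Definition normalized (S : R) s : R := 1 / Num.sqrt S * wsum GG s.

Hypothesis dv_top : {in GG, forall n, dv n (top n)}.

Lemma with_topE i : with_top i \subset multiples i.
Proof.
apply/fintype.subsetP => n; rewrite !inE => /andP[nG /eqP <-].
by rewrite nG dv_top.
Qed.

Lemma wsum_top s : wsum GG s = \sum_i wsum (with_top i) s.
Proof.
rewrite /wsum (partition_big top xpredT)//=; apply: eq_bigr => i _.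
by apply: eq_bigl => n; rewrite inE.
Qed.

Lemma wsum_with_top_flip i s :
  wsum (with_top i) (flip i s) = - wsum (with_top i) s.
Proof.
rewrite /wsum -sumrN; apply: eq_bigr => n; rewrite inE => /andP[nG /eqP ni].
by rewrite walsh_flip -ni dv_top// expr1 mulN1r.
Qed.

Lemma wsum_flip i s :
  wsum GG s - wsum GG (flip i s) = 2 * wsum (multiples i) s.
Proof.
rewrite /wsum -sumrB mulr_sumr big_mkcond [RHS]big_mkcond/=.
apply: eq_bigr => n _; rewrite inE; case: (n \in GG) => //=.
rewrite walsh_flip; case: (dv n i); rewrite ?expr1 ?expr0; ring.
Qed.

(* Flipping the sign [i] negates [wsum (with_top i)] and moves [W] by
   [2 wsum (multiples i) / sqrt S]: this is the exchangeable pair of the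
   argument. *)
Lemma stein_discrepancy (g dg : R -> R) (C S : R) :
  (forall t : R, is_derive t 1 g (dg t)) -> (forall t, `|dg t| <= C) ->
  (forall t u, `|dg t - dg u| <= C * `|t - u|) -> 0 < S ->
  `|E (fun s => dg (normalized S s) - normalized S s * g (normalized S s))| <=
   C * E (fun s => `|1 - (\sum_i wsum (with_top i) s * wsum (multiples i) s) / S|)
   + 2 * C / (S * Num.sqrt S) * \sum_i
     E (fun s => `|wsum (with_top i) s| * wsum (multiples i) s ^+ 2).
Proof.
move=> gE dgC dgL S0; set W := normalized S.
pose r := Num.sqrt S.
have r0 : 0 < r by rewrite sqrtr_gt0.
have rr : r * r = S by rewrite -expr2 sqr_sqrtr// ltW.
have taylor a b : `|g a - g b - (a - b) * dg a| <= C * (a - b) ^+ 2.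
  have C0 : 0 <= C by apply: le_trans (dgC 0).
  have tay u v t : u <= v -> u <= t <= v ->
      `|g v - g u - (v - u) * dg t| <= C * (v - u) ^+ 2.
    move=> uv /andP[ut tv].
    have [c /andP[uc cv] ->] := is_derive_MVT uv (fun t _ => gE t).
    rewrite [_ * dg t]mulrC -mulrBl normrM (ger0_norm (x := v - u)) ?subr_ge0//.
    rewrite expr2 mulrA ler_wpM2r ?subr_ge0//.
    apply: le_trans (dgL _ _) _; rewrite ler_wpM2l// ler_norml; lra.
  have [ab|/ltW ba] := leP a b; last by apply: tay => //; rewrite lexx ba.
  have -> : g a - g b - (a - b) * dg a = - (g b - g a - (b - a) * dg a) by ring.
  have -> : (a - b) ^+ 2 = (b - a) ^+ 2 by ring.
  rewrite normrN.
  by apply: tay => //; rewrite lexx ab.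
pose Ri i s := wsum (with_top i) s.
pose Ui i s := wsum (multiples i) s.
have EW i : `|E (fun s => Ri i s * g (W s)) - E (fun s => Ri i s * Ui i s * dg (W s)) / r|
    <= 2 * C / S * E (fun s => `|Ri i s| * Ui i s ^+ 2).
  (* [Ri] is odd under the flip, so averaging with the flipped vector replaces [g (W s)] by half a
     difference. *)
  have E1 : E (fun s => Ri i s * g (W s)) =
      2^-1 * E (fun s => Ri i s * (g (W s) - g (W (flip i s)))).
    have -> : E (fun s => Ri i s * (g (W s) - g (W (flip i s)))) =
        E (fun s => Ri i s * g (W s)) + E (fun s => Ri i s * g (W s)).
      rewrite -[X in _ = _ + X](sign_mean_flip i) -sign_meanD.
      apply: eq_sign_mean => s /=; rewrite /Ri wsum_with_top_flip; ring.
    by set e := E _; rewrite -mulr2n -[e *+ 2]mulr_natl mulKf.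
  have -> : E (fun s => Ri i s * g (W s)) - E (fun s => Ri i s * Ui i s * dg (W s)) / r =
      E (fun s => 2^-1 * (Ri i s * (g (W s) - g (W (flip i s)))) +
        -1 * (r^-1 * (Ri i s * Ui i s * dg (W s)))).
    by rewrite sign_meanD !sign_meanZ mulN1r E1 [_ / r]mulrC.
  apply: le_trans (ler_norm_sign_mean _) _.
  rewrite -sign_meanZ; apply: ler_sign_mean => s.
  have WW : W s - W (flip i s) = 2 * Ui i s / r.
    by rewrite /W /normalized -mulrBr wsum_flip -/r /Ui; field; rewrite gt_eqF.
  have := taylor (W s) (W (flip i s)); rewrite WW => tay.
  set a := g (W s) in tay *; set b := g (W (flip i s)) in tay *.
  set x := Ri i s; set u := Ui i s in tay *; set e := dg (W s) in tay *.
  have -> : 2^-1 * (x * (a - b)) + -1 * (r^-1 * (x * u * e)) =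
      2^-1 * x * (a - b - 2 * u / r * e) by field; rewrite gt_eqF.
  rewrite !normrM ger0_norm ?invr_ge0//.
  have -> : 2 * C / S * (`|x| * u ^+ 2) = 2^-1 * `|x| * (C * (2 * u / r) ^+ 2).
    by rewrite -rr; field; rewrite gt_eqF.
  by rewrite ler_wpM2l// mulr_ge0// invr_ge0.
pose T s := \sum_i Ri i s * Ui i s.
have EWg : E (fun s => W s * g (W s)) = \sum_i E (fun s => Ri i s * g (W s)) / r.
  rewrite -mulr_suml -sign_mean_sum mulrC -sign_meanZ; apply: eq_sign_mean => s.
  set gw := g (W s).
  by rewrite /W /normalized wsum_top -/r -mulr_suml /Ri; field; rewrite gt_eqF.
have ET : E (fun s => T s / S * dg (W s)) =
    \sum_i E (fun s => Ri i s * Ui i s * dg (W s)) / r / r.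
  rewrite -!mulr_suml -sign_mean_sum -mulrA -invfM rr mulrC -sign_meanZ.
  apply: eq_sign_mean => s; set dw := dg (W s).
  by rewrite /T -mulr_suml; field; rewrite gt_eqF.
(* The derivative terms cancel up to the fluctuation [1 - T / S]; the second difference is the
   Taylor remainder. *)
have split1 : E (fun s => dg (W s) - W s * g (W s)) =
    E (fun s => (1 - T s / S) * dg (W s)) -
    (\sum_i E (fun s => Ri i s * g (W s)) / r -
     \sum_i E (fun s => Ri i s * Ui i s * dg (W s)) / r / r).
  rewrite -EWg -ET opprB -mulN1r -sign_meanZ -!sign_meanD.
  by apply: eq_sign_mean => s; ring.
rewrite split1; apply: le_trans (ler_normB _ _) _; apply: lerD.
  apply: le_trans (ler_norm_sign_mean _) _; rewrite -sign_meanZ.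
  by apply: ler_sign_mean => s; rewrite normrM mulrC ler_wpM2r.
rewrite -sumrB; apply: le_trans (ler_norm_sum _ _ _) _.
rewrite mulr_sumr; apply: ler_sum => i _.
rewrite -mulrBl normrM normfV (gtr0_norm r0) ler_pdivrMr//.
apply: le_trans (EW i) _; set e := E _; rewrite le_eqVlt; apply/orP; left.
by apply/eqP; rewrite -/r -rr; field; rewrite gt_eqF.
Qed.

End WalshSums.

Section WalshMoments.
Context {R : realType} {I J : finType}.
Variables (dv : J -> I -> bool) (top : J -> I) (GG : {set J}).
Local Notation Om := {ffun I -> bool}.
Local Notation E := (@sign_mean R I).
Local Notation chi n := (@walsh R I (dv n)).
Implicit Types (s : Om) (n m : J) (i : I) (u v : J * J) (H : {set J}).

Hypothesis dv_inj : {in GG &, forall n m, dv n =1 dv m -> n = m}.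
Hypothesis dv_top : {in GG, forall n, dv n (top n)}.

(** By orthogonality a product of four characters has mean [1] or [0] according to [even4], so the
    moment is a count. *)
Lemma pair_moment (P : {set J * J}) :
  E (fun s => (\sum_(u in P) chi u.1 s * chi u.2 s) ^+ 2) =
  (\sum_(u in P) \sum_(v in P) even4 dv u v)%:R.
Proof.
rewrite natr_sum.
transitivity (E (fun s => \sum_(u in P) \sum_(v in P)
    chi u.1 s * chi u.2 s * (chi v.1 s * chi v.2 s))).
  by apply: eq_sign_mean => s; rewrite expr2 big_distrlr.
rewrite sign_mean_sum; apply: eq_bigr => u _.
rewrite sign_mean_sum natr_sum; apply: eq_bigr => v _.
rewrite /even4 -sign_mean_walsh; apply: eq_sign_mean => s.
by rewrite !walshM.
Qed.

(** If the first entry coincides with another, their parities cancel and the remaining two have the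
    same divisors, hence are equal. The first three summands are the three ways to pair four
    entries. *)
Lemma even4_le H u v : H \subset GG ->
  u.1 \in H -> u.2 \in H -> v.1 \in H -> v.2 \in H ->
  (even4 dv u v <= ((u.1 == u.2) && (v.1 == v.2)) + (u == v) +
     (u == (v.2, v.1)) + ((u, v) \in off_diagonal dv H))%N.
Proof.
move=> HG u1 u2 v1 v2; have inG := fintype.subsetP HG.
rewrite inE /= u1 u2 v1 v2 /=.
case: (boolP (even4 dv u v)) => //= /forallP ev.
have eq2 n m n' m' : n \in H -> m \in H -> n' = m' ->
    (forall i, dv n i (+) dv m i (+) (dv n' i (+) dv m' i) = false) -> n = m.
  move=> nH mH <- nm; apply: dv_inj; [exact: inG|exact: inG|move=> i].
  by have := nm i; rewrite addbb addbF; case: (dv n i) (dv m i) => -[].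
have e i := negbTE (ev i).
have [E12|N12] := eqVneq u.1 u.2.
  have -> : v.1 = v.2; last by rewrite eqxx.
  by apply: (eq2 _ _ _ _ v1 v2 E12) => i; rewrite addbC e.
have [E13|N13] := eqVneq u.1 v.1.
  have E24 : u.2 = v.2.
    apply: (eq2 _ _ _ _ u2 v2 E13) => i; rewrite -(e i).
    by case: (dv u.1 i) (dv u.2 i) (dv v.1 i) (dv v.2 i) => -[] [] [].
  have -> : u = v; last by rewrite eqxx.
  by move: E13 E24; case: (u) (v) => [a b] [c d] /= -> ->.
have [E14|N14] := eqVneq u.1 v.2.
  have E23 : u.2 = v.1.
    apply: (eq2 _ _ _ _ u2 v1 E14) => i; rewrite -(e i).
    by case: (dv u.1 i) (dv u.2 i) (dv v.1 i) (dv v.2 i) => -[] [] [].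
  have -> : u = (v.2, v.1); last by rewrite eqxx; lia.
  by move: E14 E23; case: (u) (v) => [a b] [c d] /= -> ->.
by rewrite addnC.
Qed.

Lemma sum_eq_op (P : {set J * J}) (f : J * J -> J * J) : injective f ->
  (\sum_(u in P) \sum_(v in P) (u == f v) <= #|P|)%N.
Proof.
move=> finj; rewrite exchange_big/= -sum1_card; apply: leq_sum => v _.
apply: leq_trans (_ : \sum_u (u == f v) <= 1)%N.
  by rewrite [leqRHS](bigID (mem P))/= leq_addr.
by rewrite (bigD1 (f v))//= eqxx big1// => u /negbTE ->.
Qed.

Lemma sum_off_diagonal (P : {set J * J}) H :
  (\sum_(u in P) \sum_(v in P) ((u, v) \in off_diagonal dv H) <=
    #|off_diagonal dv H|)%N.
Proof.
apply: leq_trans (_ : \sum_u \sum_v ((u, v) \in off_diagonal dv H) <= _)%N.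
  rewrite [leqRHS](bigID (mem P))/=; apply: leq_trans (leq_addr _ _).
  by apply: leq_sum => u _; rewrite [leqRHS](bigID (mem P))/= leq_addr.
rewrite pair_bigA/= -sum1_card [leqRHS]big_mkcond/=.
by apply: leq_sum => -[u v] _ /=; case: (_ \in _).
Qed.

Lemma swap_inj : injective (fun v : J * J => (v.2, v.1)).
Proof. by move=> [a b] [c d] /= [-> ->]. Qed.

(** Each of the three pairings contributes at most [#|H|^2]. *)
Lemma fourth_moment H : H \subset GG ->
  E (fun s => wsum dv H s ^+ 4) <=
  (3 * #|H| ^ 2 + #|off_diagonal dv H|)%N%:R.
Proof.
move=> HG; pose P : {set J * J} := [set u | (u.1 \in H) && (u.2 \in H)]%SET.
have cP : #|P| = (#|H| ^ 2)%N.
  have -> : P = finset.setX H H by apply/finset.setP => u; rewrite !inE.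
  by rewrite cardsX mulnn.
have -> : E (fun s => wsum dv H s ^+ 4) =
    E (fun s => (\sum_(u in P) chi u.1 s * chi u.2 s) ^+ 2).
  apply: eq_sign_mean => s; rewrite -[4%N]/(2 * 2)%N exprM; congr (_ ^+ 2).
  rewrite expr2 /wsum big_distrlr/= pair_big/=.
  by apply: eq_bigl => u; rewrite inE.
rewrite pair_moment ler_nat.
apply: leq_trans (_ : \sum_(u in P) \sum_(v in P)
    (((u.1 == u.2) && (v.1 == v.2)) + (u == v) +
     (u == (v.2, v.1)) + ((u, v) \in off_diagonal dv H)) <= _)%N.
  apply: leq_sum => u; rewrite inE => /andP[u1 u2].
  apply: leq_sum => v; rewrite inE => /andP[v1 v2]; exact: even4_le.
under eq_bigr do rewrite !big_split/=.
rewrite !big_split/= leq_add ?sum_off_diagonal//.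
rewrite !mulSn mul0n addn0 addnA.
apply: leq_add; last by rewrite -cP; exact: (sum_eq_op _ swap_inj).
apply: leq_add; last by rewrite -cP; exact: (@sum_eq_op P id (fun u v uv => uv)).
have diag : (\sum_(u in P) (u.1 == u.2) <= #|H|)%N.
  rewrite -sum1_card (eq_bigl (fun u : J * J => (u.1 \in H) && (u.2 \in H))).
    rewrite -(pair_big (mem H) (mem H) (fun n m => nat_of_bool (n == m)))/=.
    apply: leq_sum => n nH; rewrite (bigD1 n)//= eqxx big1// => m /andP[_].
    by rewrite eq_sym => /negbTE ->.
  by move=> u; rewrite inE.
apply: leq_trans (leq_mul diag diag).
rewrite big_distrlr/=; apply: leq_sum => u _; apply: leq_sum => v _.
by case: (_ == _) (_ == _) => -[].
Qed.

(** The diagonal terms [n = m] of [sum_p R_p U_p] are [X(n)^2 = 1], which is exactly the subtracted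
    [#|GG|]. Of the three pairings only two remain, since related pairs have distinct entries. *)
Lemma variance_bound :
  E (fun s => (\sum_i wsum dv (with_top top GG i) s *
      wsum dv (multiples dv GG i) s - #|GG|%:R) ^+ 2) <=
  (2 * #|related_pairs dv top GG| + #|off_diagonal dv GG|)%N%:R.
Proof.
set P := related_pairs dv top GG.
have -> : E (fun s => (\sum_i wsum dv (with_top top GG i) s *
      wsum dv (multiples dv GG i) s - #|GG|%:R) ^+ 2) =
    E (fun s => (\sum_(u in P) chi u.1 s * chi u.2 s) ^+ 2).
  apply: eq_sign_mean => s; congr (_ ^+ 2).
  transitivity (\sum_(n in GG) \sum_(m in GG | dv m (top n)) chi n s * chi m s
      - #|GG|%:R).
    congr (_ - _); rewrite [RHS](partition_big top xpredT)//=.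
    apply: eq_bigr => i _; rewrite /wsum mulr_suml.
    apply: eq_big => [n|n]; first by rewrite inE.
    rewrite inE => /andP[nG /eqP <-]; rewrite mulr_sumr.
    by apply: eq_bigl => m; rewrite inE.
  rewrite -sum1_card natr_sum -sumrB.
  transitivity (\sum_(n in GG) \sum_(m | [&& m \in GG, n != m & dv m (top n)])
      chi n s * chi m s).
    apply: eq_bigr => n nG.
    rewrite (bigD1 n) ?nG ?dv_top//= walsh_sqr addrAC subrr add0r.
    by apply: eq_bigl => m; rewrite eq_sym andbA andbAC.
  rewrite pair_big_dep/=; apply: eq_bigl => u.
  by rewrite inE.
rewrite pair_moment ler_nat.
apply: leq_trans (_ : \sum_(u in P) \sum_(v in P) ((u == v) +
     (u == (v.2, v.1)) + ((u, v) \in off_diagonal dv GG)) <= _)%N.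
  apply: leq_sum => u; rewrite inE => /and4P[u1 u2 u12 _].
  apply: leq_sum => v; rewrite inE => /and4P[v1 v2 _ _].
  apply: leq_trans (even4_le (fintype.subxx _) u1 u2 v1 v2) _.
  by rewrite (negbTE u12).
under eq_bigr do rewrite !big_split/=.
rewrite !big_split/= leq_add ?sum_off_diagonal//.
rewrite mul2n -addnn; apply: leq_add; last exact: (sum_eq_op _ swap_inj).
exact: (@sum_eq_op P id (fun u v uv => uv)).
Qed.

End WalshMoments.

(** * Counting products in a short interval *)

Section Counting.
Lemma card_ord_interval (K l m : nat) :
  (#|[pred n : 'I_K | l <= n <= l + m]| <= m.+1)%N.
Proof.
rewrite cardE -(size_map val) -[leqRHS](size_iota l); apply: uniq_leq_size.
  by rewrite (map_inj_uniq val_inj) enum_uniq.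
move=> _ /mapP[n + ->]; rewrite mem_enum inE mem_iota addnS => /andP[-> ?].
by rewrite ltnS.
Qed.

Lemma card_progression (K x y A : nat) : (0 < A)%N ->
  (#|[pred c : 'I_K | x < A * c <= x + y]| <= (y %/ A).+1)%N.
Proof.
move=> A0; apply: leq_trans (card_ord_interval K (x %/ A).+1 (y %/ A)).
apply/subset_leq_card/fintype.subsetP => c; rewrite !inE => /andP[xc cy].
have := divn_eq x A; have := divn_eq y A.
have := ltn_pmod x A0; have := ltn_pmod y A0; nia.
Qed.

Lemma card_window (K x y b : nat) : (0 < x)%N ->
  (#|[pred n : 'I_K | x * b < (x + y) * n & x * n < (x + y) * b]| <=
    (2 * (y * b %/ x)).+1)%N.
Proof.
move=> x0.
apply: leq_trans (card_ord_interval K (b - y * b %/ x) (2 * (y * b %/ x))).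
apply/subset_leq_card/fintype.subsetP => n; rewrite !inE => /andP[bn nb].
have := divn_eq (y * b) x; have := ltn_pmod (y * b) x0.
set k := (_ %/ _)%N; set r := (_ %% _)%N; nia.
Qed.

(** Removing the centre [b] saves the [1] of [card_window], so the count vanishes when [y b < x] and
    stays proportional to [delta b]. If [b] is not in its own window, the window is empty. *)
Lemma card_window_neq (K x y : nat) (b : 'I_K) : (0 < x)%N ->
  (#|[pred n : 'I_K | [&& (x * b < (x + y) * n), (x * n < (x + y) * b) & b != n]]|
    <= 2 * (y * b %/ x))%N.
Proof.
move=> x0.
set W := [pred n : 'I_K | (x * b < (x + y) * n) && (x * n < (x + y) * b)]%N.
have [Wb|Wb] := boolP (b \in W).
  rewrite -ltnS; apply: leq_trans (card_window K y b x0).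
  rewrite [leqRHS](cardD1 b) Wb add1n ltnS.
  apply/subset_leq_card/fintype.subsetP => n; rewrite !inE eq_sym.
  by case/and3P=> -> -> ->.
rewrite (eq_card0 (A := [pred n : 'I_K | _])) ?leq0n// => n.
rewrite inE; apply/negP => /and3P[xn nx _]; move: Wb; rewrite inE.
by move: xn nx; set m := nat_of_ord b; nia.
Qed.

(** Dividing the product of the first two members by that of the last two leaves [(a / a')^2], which
    is less than [((x + y) / x)^2]. *)
Lemma near_of_bands (x y p a a' b b' c c' : nat) :
  (x < p * (a * b * c) <= x + y)%N -> (x < p * (a * b' * c') <= x + y)%N ->
  (x < p * (a' * b * c') <= x + y)%N -> (x < p * (a' * b' * c) <= x + y)%N ->
  (x * a < (x + y) * a')%N.
Proof.
move=> /andP[h1 h1'] /andP[h2 h2'] /andP[h3 h3'] /andP[h4 h4'].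
rewrite ltnNge; apply/negP => le.
pose M := (p * p * (b * c * (b' * c')))%N.
have e1 : ((a * a) * M <= (x + y) * (x + y))%N.
  by apply: leq_trans (leq_mul h1' h2'); rewrite /M; lia.
have e2 : (x * x < (a' * a') * M)%N.
  apply: leq_trans (ltn_mul h3 h4) _; rewrite /M; lia.
have e3 : (((x + y) * a') * ((x + y) * a') * M <= x * a * (x * a) * M)%N.
  by rewrite leq_mul2r leq_mul ?orbT.
have e4 : (x * a * (x * a) * M <= x * x * ((x + y) * (x + y)))%N.
  by have := leq_mul (leqnn (x * x)%N) e1; lia.
have xy0 : (0 < (x + y) * (x + y))%N.
  rewrite muln_gt0 andbb; apply: leq_trans h1'; exact: leq_ltn_trans h1.
have : (x * x * ((x + y) * (x + y)) < a' * a' * M * ((x + y) * (x + y)))%N.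
  by rewrite ltn_pmul2r.
lia.
Qed.

End Counting.

(** * Harmonic and inverse square sums *)

Section HarmonicSums.
Context {R : realType}.

Lemma sum_inv_sqr_tail (z K : nat) : (0 < z)%N ->
  \sum_(k < K | (z < k)%N) (k%:R ^- 2 : R) <= z%:R^-1.
Proof.
move=> z0; have z0' : 0 < z%:R :> R by rewrite ltr0n.
case: K => [|K]; first by rewrite big_ord0 invr_ge0 ltW.
(* Telescoping form, from [1 / (k + 1)^2 <= 1 / k - 1 / (k + 1)]; [maxn] covers the range where the
   sum is still empty. *)
suff H : \sum_(k < K.+1 | (z < k)%N) (k%:R ^- 2 : R) <= z%:R^-1 - (maxn z K)%:R^-1.
  by apply: le_trans H _; rewrite gerBl invr_ge0.
elim: K => [|K IH].
  by rewrite big_mkcond/= big_ord_recr/= big_ord0 addr0 maxn0 subrr.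
rewrite big_mkcond big_ord_recr/= -big_mkcond/=; case: ltnP => zK; last first.
  by rewrite addr0; move: IH; rewrite (maxn_idPl _)//; lia.
apply: le_trans (lerD IH (lexx _)) _.
rewrite (maxn_idPr _)//.
have K0 : 0 < K%:R :> R by rewrite ltr0n; lia.
rewrite -addrA lerD2l -natr1 -subr_ge0.
move: K0; set k : R := K%:R => k0.
have -> : - (k + 1)^-1 - (- k^-1 + (k + 1) ^- 2) = k^-1 / (k + 1) ^+ 2.
  by field; rewrite !gt_eqF//; lra.
by rewrite divr_ge0 ?invr_ge0 ?exprn_ge0 ?addr_ge0// ltW.
Qed.

Lemma sum_inv_sqr (K : nat) : \sum_(k < K) (k%:R ^- 2 : R) <= 2.
Proof.
rewrite (bigID (fun k : 'I_K => 1 < k)%N)/= -[leRHS]/(1 + 1) lerD//.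
  by have := @sum_inv_sqr_tail 1 K isT; rewrite invr1.
case: K => [|[|K]].
- by rewrite big_ord0.
- by rewrite big_mkcond big_ord_recl/= big_ord0 expr0n/= invr0 addr0.
- rewrite big_mkcond/= 2!big_ord_recl/= big1 ?addr0; last by move=> i _.
  by rewrite expr0n/= invr0 add0r expr1n invr1.
Qed.

(** Each step uses [1 / n <= ln (n / (n - 1))]; the term [k = 0] vanishes because the inverse of [0]
    is [0]. *)
Lemma harmonic_le_ln (K : nat) : \sum_(k < K.+2) (k%:R^-1 : R) <= 1 + ln K.+1%:R.
Proof.
elim: K => [|K IH].
  by rewrite !big_ord_recr/= big_ord0 invr0 ln1 !add0r addr0 invr1.
rewrite big_ord_recr/=; apply: le_trans (lerD IH (lexx _)) _.
rewrite -addrA lerD2l -lerBrDl.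
have K2 : 0 < K.+2%:R^-1 :> R by rewrite invr_gt0.
have : ln (1 + - K.+2%:R^-1) <= - K.+2%:R^-1 :> R.
  by apply: le_ln1Dx; rewrite ltrN2 invf_lt1// ltr1n.
have -> : 1 + - K.+2%:R^-1 = K.+1%:R / K.+2%:R :> R.
  have : 0 < K.+1%:R :> R by [].
  rewrite -[K.+2%:R]natr1; move: (K.+1%:R : R) => k k0.
  by field; rewrite gt_eqF//; lra.
by rewrite ln_div ?posrE// lerNr opprB.
Qed.
End HarmonicSums.

Lemma sum_bool_card (T : finType) (P : pred T) :
  (\sum_t P t = #|[pred t | P t]|)%N.
Proof.
by rewrite -sum1_card [RHS]big_mkcond/=; apply: eq_bigr => t _; rewrite inE; case: ifP.
Qed.

(** * Counting six-tuples of factors *)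

Section SixTuples.
Context {R : realType}.
Variables (x y p K : nat).
Hypothesis x0 : (0 < x)%N.
Hypothesis yx : (10 * y <= x)%N.
Local Notation pairs := ('I_K * 'I_K)%type.

Definition band (m : nat) : bool := (x < p * m <= x + y)%N.

(** Only two of the three pairs must be nontrivial: this is what survives off the diagonal, and
    [quad] permutes the roles so that these two come last. *)
Definition is_six_tuple (a a' b b' c c' : 'I_K) : bool :=
  [&& band (a * b * c), band (a * b' * c'), band (a' * b * c'),
      band (a' * b' * c), b != b' & c != c'].

Definition six_tuples : {set pairs * pairs * pairs} :=
  [set t | is_six_tuple t.1.1.1 t.1.1.2 t.1.2.1 t.1.2.2 t.2.1 t.2.2].

Definition near (a a' : 'I_K) : bool :=
  (x * a < (x + y) * a')%N && (x * a' < (x + y) * a)%N.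

Lemma six_tuples_near a a' b b' c c' : ((a, a'), (b, b'), (c, c')) \in six_tuples ->
  [/\ near a a', near b b' & near c c'].
Proof.
rewrite inE => /and5P[/= h1 h2 h3 h4 _].
have F := near_of_bands; split; apply/andP; split.
- exact: F h1 h2 h3 h4.
- exact: F h3 h4 h1 h2.
- apply: (F x y p b b' a a' c c'); by rewrite ?[(b * _)%N]mulnC ?[(b' * _)%N]mulnC.
- apply: (F x y p b' b a a' c' c); by rewrite ?[(b * _)%N]mulnC ?[(b' * _)%N]mulnC.
- apply: (F x y p c c' a a' b b'); move: h1 h2 h3 h4; rewrite /band; lia.
- apply: (F x y p c' c a a' b' b); move: h1 h2 h3 h4; rewrite /band; lia.
Qed.

(* For fixed [a, a', b, b'] the last pair is confined to progressions of
   moduli [p a b] and [p a b'], which are at most [11 y / 10] because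
   [c <> c'] forces [c > x / y]. *)
Lemma card_last_pair (a a' b b' : 'I_K) :
  \sum_c \sum_c' (((a, a'), (b, b'), (c, c')) \in six_tuples)%:R <=
  (near a a')%:R * (near b b' && (b != b'))%:R *
    (10 * (y%:R / p%:R) ^+ 2 * (a%:R ^- 2 * b%:R ^- 2)) :> R.
Proof.
have [/existsP[c0 /existsP[c0' t0]]|/existsPn none] :=
    boolP [exists c, exists c', ((a, a'), (b, b'), (c, c')) \in six_tuples]; last first.
  rewrite big1 => [|c _]; last first.
    by rewrite big1// => c' _; have /existsPn/(_ c')/negbTE -> := none c.
  by rewrite !mulr_ge0// invr_ge0 exprn_ge0.
have [naa' nbb' ncc'] := six_tuples_near t0.
move: (t0); rewrite inE => /and5P[/= h1 h2 h3 h4 /andP[bb' cc']].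
rewrite naa' nbb' bb' !mul1r.
pose A := (p * (a * b))%N; pose A' := (p * (a * b'))%N.
have /andP[Ac Ac2] : (x < A * c0 <= x + y)%N by move: h1; rewrite /band /A mulnA.
have /andP[Ac' Ac2'] : (x < A' * c0' <= x + y)%N by move: h2; rewrite /band /A' mulnA.
have A0 : (0 < A)%N by case: (A) Ac.
have A0' : (0 < A')%N by case: (A') Ac'.
(* [c0] and [c0'] are distinct integers with ratio within [1 + y / x] of [1], so both exceed
   [x / y]. *)
have /andP[xyc xyc'] : (x < y * c0)%N && (x < y * c0')%N.
  case/andP: ncc' => n1 n2; move: cc' n1 n2; rewrite -val_eqE/=.
  move: (nat_of_ord c0) (nat_of_ord c0') (x) (y); clear => u v x y.
  rewrite neq_ltn !mulnDl => /orP[uv|vu] xu xv; apply/andP; split.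
  - have := leq_mul (leqnn x) uv; rewrite mulnS; lia.
  - have := leq_mul (leqnn x) uv; have := leq_mul (leqnn y) uv; rewrite !mulnS; lia.
  - have := leq_mul (leqnn x) vu; have := leq_mul (leqnn y) vu; rewrite !mulnS; lia.
  - have := leq_mul (leqnn x) vu; rewrite mulnS; lia.
have modulus B c : (x < y * c)%N -> (B * c <= x + y)%N -> (0 < B)%N ->
    (10 * B <= 11 * y)%N.
  move=> xc Bc B0; rewrite leqNgt; apply/negP => yB.
  have Bx : (B * x < y * (x + y))%N.
    apply: leq_trans (_ : B * (y * c) <= _)%N; first by rewrite ltn_pmul2l.
    by rewrite mulnCA leq_mul2l Bc orbT.
  have := leq_mul yB (leqnn x); have := leq_mul (leqnn y) yx.
  by move: Bx; clear; lia.
have A11 := modulus _ _ xyc Ac2 A0.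
have A11' := modulus _ _ xyc' Ac2' A0'.
have b11 : (10 * b <= 11 * b')%N.
  case/andP: nbb' => n1 _; move: n1 x0 yx.
  move: (nat_of_ord b) (nat_of_ord b') (x) (y); clear; nia.
have abp : [&& 0 < p, 0 < a & 0 < b]%N by move: A0; rewrite /A !muln_gt0.
have b'0 : (0 < b')%N by move: A0'; rewrite /A' !muln_gt0 => /and3P[].
case/and3P: abp => p0 a0 b0.
(* [y / B + 1 <= 3 y / B] because [B] is at most [11 y / 10]. *)
have cnt B : (0 < B)%N -> (10 * B <= 11 * y)%N ->
    \sum_(c < K) (x < B * c <= x + y)%N%:R <= 3 * (y%:R / B%:R) :> R.
  move=> B0 B11; have B0' : 0 < B%:R :> R by rewrite ltr0n.
  rewrite -natr_sum.
  have -> : (\sum_(c < K) (x < B * c <= x + y) = #|[pred c : 'I_K | x < B * c <= x + y]|)%N.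
    exact: sum_bool_card.
  apply: le_trans (_ : (y %/ B).+1%:R <= _).
    by rewrite ler_nat card_progression.
  rewrite mulrA ler_pdivlMr// -!natrM.
  by rewrite ler_nat mulSn; have := leq_trunc_div y B; move: B11; clear; lia.
apply: le_trans (_ : (\sum_(c < K) (x < A * c <= x + y)%N%:R) *
   (\sum_(c < K) (x < A' * c <= x + y)%N%:R) <= _).
  rewrite big_distrlr/=; apply: ler_sum => c _; apply: ler_sum => c' _.
  rewrite -natrM ler_nat inE.
  case: (boolP (is_six_tuple _ _ _ _ _ _)) => // /and5P[H1 H2 _ _ _] /=.
  have -> : (x < A * c <= x + y)%N by move: H1; rewrite /band /A mulnA.
  by have -> : (x < A' * c' <= x + y)%N by move: H2; rewrite /band /A' mulnA.
apply: le_trans (ler_pM _ _ (cnt _ A0 A11) (cnt _ A0' A11')) _.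
- by apply: sumr_ge0 => *.
- by apply: sumr_ge0 => *.
move: b11; rewrite /A /A' !natrM -(ler_nat R) !natrM.
have : 0 < a%:R :> R by rewrite ltr0n.
have : 0 < b%:R :> R by rewrite ltr0n.
have : 0 < b'%:R :> R by rewrite ltr0n.
have : 0 < p%:R :> R by rewrite ltr0n.
have : 0 <= y%:R :> R by [].
move: (a%:R : R) (b%:R : R) (b'%:R : R) (p%:R : R) (y%:R : R) => u v v' q w.
clear=> w0 q0 v'0 v0 u0 v11.
rewrite -subr_ge0.
(* Replacing [b'] by [b] costs at most [11 / 10], and [3 * 3 * 11 / 10 < 10]. *)
have -> : 10 * (w / q) ^+ 2 * (u ^- 2 * v ^- 2) -
    3 * (w / (q * (u * v))) * (3 * (w / (q * (u * v')))) =
    (w / (q * u)) ^+ 2 / (v ^+ 2 * v') * (10 * v' - 9 * v).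
  by field; rewrite !gt_eqF.
rewrite mulr_ge0//; last by lra.
by rewrite divr_ge0 ?sqr_ge0// mulr_ge0 ?sqr_ge0// ltW.
Qed.

(** The pair [(a, a')] may be trivial, so [a'] has up to [2 delta a + 1] values, while [b' != b]
    leaves at most [2 delta b]. After summation against [1 / a^2] and [1 / b^2] only the second
    factor is sure to gain a [delta]. *)
Lemma card_six_tuples (del : R) : y%:R = del * x%:R ->
  #|six_tuples|%:R <= 10 * (y%:R / p%:R) ^+ 2 * ((2 * del * (\sum_(k < K) k%:R^-1) + 2) * (2 * del * (\sum_(k < K) k%:R^-1))) :> R.
Proof.
move=> ydel; set H := \sum_(k < K) k%:R^-1.
have x0' : 0 < x%:R :> R by rewrite ltr0n.
have del0 : 0 <= del by rewrite -(pmulr_lge0 _ x0') -ydel.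
have quot (b : nat) : (y * b %/ x)%:R <= del * b%:R :> R.
  rewrite -(ler_pM2r x0') -natrM; apply: le_trans (_ : (y * b)%:R <= _).
    by rewrite ler_nat leq_trunc_div.
  by rewrite natrM ydel mulrAC.
have Ha : \sum_(a < K) \sum_(a' < K) (near a a')%:R * a%:R ^- 2 <= 2 * del * H + 2.
  apply: le_trans (_ : \sum_(a < K) (2 * del * a%:R^-1 + a%:R ^- 2) <= _); last first.
    by rewrite big_split/= -mulr_sumr lerD2l sum_inv_sqr.
  apply: ler_sum => a _; rewrite -mulr_suml -natr_sum.
  have -> : (\sum_(a' < K) near a a' = #|[pred a' | near a a']|)%N.
    exact: sum_bool_card.
  have [a0|a0] := posnP a; first by rewrite a0 expr0n/= invr0 !mulr0 addr0.
  have a0' : 0 < a%:R :> R by rewrite ltr0n.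
  have -> : 2 * del * a%:R^-1 + a%:R ^- 2 = (2 * del * a%:R + 1) * a%:R ^- 2 :> R.
    by field; rewrite gt_eqF.
  rewrite ler_wpM2r// ?invr_ge0 ?exprn_ge0//.
  apply: le_trans (_ : (2 * (y * a %/ x)).+1%:R <= _).
    by rewrite ler_nat; exact: card_window.
  by rewrite -natr1 natrM lerD2r -mulrA ler_wpM2l.
have Hb : \sum_(b < K) \sum_(b' < K) (near b b' && (b != b'))%:R * b%:R ^- 2
    <= 2 * del * H.
  rewrite mulr_sumr; apply: ler_sum => b _; rewrite -mulr_suml -natr_sum.
  have -> : (\sum_(b' < K) (near b b' && (b != b')) =
      #|[pred b' | near b b' && (b != b')]|)%N.
    exact: sum_bool_card.
  have [b0|b0] := posnP b; first by rewrite b0 expr0n/= invr0 !mulr0.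
  have b0' : 0 < b%:R :> R by rewrite ltr0n.
  have -> : 2 * del * b%:R^-1 = (2 * del * b%:R) * b%:R ^- 2 :> R.
    by field; rewrite gt_eqF.
  rewrite ler_wpM2r// ?invr_ge0 ?exprn_ge0//.
  apply: le_trans (_ : (2 * (y * b %/ x))%:R <= _).
    rewrite ler_nat; apply: leq_trans (card_window_neq y b x0).
    by apply/subset_leq_card/fintype.subsetP => n; rewrite !inE => /andP[/andP[-> ->] ->].
  by rewrite natrM -mulrA ler_wpM2l.
set w := 10 * _.
have w0 : 0 <= w by rewrite mulr_ge0// sqr_ge0.
have H0 : 0 <= H by apply: sumr_ge0 => k _; rewrite invr_ge0.
have -> : #|six_tuples|%:R = \sum_(A : pairs) \sum_(B : pairs) \sum_(D : pairs)
    ((A, B, D) \in six_tuples)%:R :> R.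
  rewrite (pair_bigA _ (fun A B => \sum_D ((A, B, D) \in six_tuples)%:R))/=.
  rewrite (pair_bigA _ (fun AB D => (((AB.1, AB.2), D) \in six_tuples)%:R))/=.
  rewrite -sum1_card natr_sum big_mkcond/=; apply: eq_bigr => -[[A B] D] _ /=.
  by case: (_ \in _).
apply: le_trans (_ : \sum_(A : pairs) \sum_(B : pairs)
    (near A.1 A.2)%:R * A.1%:R ^- 2 *
    (w * ((near B.1 B.2 && (B.1 != B.2))%:R * B.1%:R ^- 2)) <= _).
  apply: ler_sum => -[a a'] _; apply: ler_sum => -[b b'] _ /=.
  have -> : \sum_(D : pairs) (((a, a'), (b, b'), D) \in six_tuples)%:R =
      \sum_c \sum_c' (((a, a'), (b, b'), (c, c')) \in six_tuples)%:R :> R.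
    by rewrite pair_bigA; apply: eq_bigr => -[c c'].
  by apply: le_trans (card_last_pair a a' b b') _; rewrite -/w le_eqVlt; apply/orP;
    left; apply/eqP; ring.
rewrite -big_distrlr/= -mulr_sumr mulrCA ler_wpM2l//.
move: Ha Hb; rewrite !pair_bigA/= => Ha Hb; apply: ler_pM => //.
- by apply: sumr_ge0 => ? _; rewrite mulr_ge0// invr_ge0 exprn_ge0.
- by apply: sumr_ge0 => ? _; rewrite mulr_ge0// invr_ge0 exprn_ge0.
Qed.

End SixTuples.

(** * Squarefree integers *)

Section SquarefreeFactorization.
Implicit Types (a b c d g m n p q : nat).

Lemma squarefree_dvd d n : squarefree n -> (d %| n)%N -> squarefree d.
Proof.
move=> /squarefreeP sn dn; apply/squarefreeP => p /sn.
by apply: contra => /dvdn_trans; apply.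
Qed.

Lemma squarefree_gt0 n : squarefree n -> (0 < n)%N.
Proof. by case/andP. Qed.

(** No prime divides both factors of a squarefree product, so the disjunction is exclusive. *)
Lemma squarefree_dvdM g a q : squarefree (g * a) -> prime q ->
  (q %| g * a)%N = (q %| g)%N (+) (q %| a)%N.
Proof.
move=> /squarefreeP sq pq; rewrite Euclid_dvdM//.
have := sq q pq; rewrite -mulnn.
case: (boolP (q %| g)%N) (boolP (q %| a)%N) => [qg|_] [qa|_] //=.
by rewrite dvdn_mul.
Qed.

Lemma squarefree_coprimeM a b : squarefree a -> squarefree b -> coprime a b ->
  squarefree (a * b).
Proof.
move=> /squarefreeP sa /squarefreeP sb cab; apply/squarefreeP => q pq.
apply/negP => qab.
have := dvdn_trans (dvdn_exp (isT : 0 < 2)%N (dvdnn q)) qab.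
rewrite Euclid_dvdM// => /orP[qa|qb].
  have cqb : coprime (q ^ 2) b by rewrite coprimeXl// (coprime_dvdl qa).
  by move: qab; rewrite Gauss_dvdl// (negbTE (sa q pq)).
have cqa : coprime (q ^ 2) a.
  by rewrite coprimeXl// (coprime_dvdl qb)// coprime_sym.
by move: qab; rewrite Gauss_dvdr// (negbTE (sb q pq)).
Qed.

Lemma squarefree_eq m n : squarefree m -> squarefree n ->
  (forall q, prime q -> (q %| m)%N = (q %| n)%N) -> m = n.
Proof.
have logE k q : squarefree k -> prime q -> logn q k = (q %| k)%N.
  move=> sk pq; have k0 := squarefree_gt0 sk; have /squarefreeP/(_ q pq) := sk.
  rewrite pfactor_dvdn// -ltnNge -[q in (q %| k)%N]expn1 pfactor_dvdn//.
  by case: (logn q k) => [|[]].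
move=> sm sn mn; apply: eqn_from_log; rewrite ?squarefree_gt0// => q.
have [pq|npq] := boolP (prime q); first by rewrite !logE// mn.
by rewrite lognE [RHS]lognE (negbTE npq).
Qed.

(** With [g = gcd(n1, n2)] and [g' = gcd(n3, n4)], the parity condition says that the cofactors
    satisfy [a b = c d]; the four-number lemma with [u = gcd(a, c)] splits this equality. *)
Lemma even4_factorization n1 n2 n3 n4 :
  squarefree n1 -> squarefree n2 -> squarefree n3 -> squarefree n4 ->
  (forall q, prime q ->
    (q %| n1)%N (+) (q %| n2)%N = (q %| n3)%N (+) (q %| n4)%N) ->
  exists g g' u t v s, [/\ n1 = (g * u * v)%N, n2 = (g * t * s)%N,
    n3 = (g' * u * s)%N & n4 = (g' * t * v)%N].
Proof.
move=> s1 s2 s3 s4 par.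
have split m n : squarefree m -> squarefree n -> exists g a b,
    [/\ m = (g * a)%N, n = (g * b)%N, coprime a b, squarefree (a * b) &
     forall q, prime q -> (q %| a * b)%N = (q %| m)%N (+) (q %| n)%N].
  move=> sm sn; have m0 := squarefree_gt0 sm.
  have [g0 /dvdnP[a ma] /dvdnP[b nb]] :
      [/\ (0 < gcdn m n)%N, (gcdn m n %| m)%N & (gcdn m n %| n)%N].
    by rewrite gcdn_gt0 m0 dvdn_gcdl dvdn_gcdr.
  move: ma nb g0 (muln_gcdl a b (gcdn m n)); set g := gcdn m n => ma nb g0.
  rewrite -ma -nb -/g -[X in _ = X]mul1n => /eqP; rewrite eqn_pmul2r// => cab.
  rewrite mulnC in ma; rewrite mulnC in nb.
  have sa : squarefree a by apply: squarefree_dvd sm _; rewrite ma dvdn_mull.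
  have sb : squarefree b by apply: squarefree_dvd sn _; rewrite nb dvdn_mull.
  have sab := squarefree_coprimeM sa sb cab.
  exists g, a, b; split => // q pq.
  rewrite squarefree_dvdM// {1}ma {1}nb !squarefree_dvdM -?ma -?nb//.
  by case: (q %| g)%N (q %| a)%N (q %| b)%N => -[] [].
have [g [a [b [e1 e2 cab sab pab]]]] := split _ _ s1 s2.
have [g' [c [d [e3 e4 ccd scd pcd]]]] := split _ _ s3 s4.
have abcd : (a * b = c * d)%N.
  by apply: squarefree_eq => // q pq; rewrite pab// pcd// par.
have c0 : (0 < c)%N by have := squarefree_gt0 scd; rewrite muln_gt0 => /andP[].
have u0 : (0 < gcdn a c)%N by rewrite gcdn_gt0 c0 orbT.
have /dvdnP[v av] := dvdn_gcdl a c; have /dvdnP[s cs] := dvdn_gcdr a c.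
move: av cs u0 (muln_gcdl v s (gcdn a c)); set u := gcdn a c => av cs u0.
rewrite -av -cs -/u -[X in _ = X]mul1n => /eqP; rewrite eqn_pmul2r// => cvs.
have vbsd : (v * b = s * d)%N.
  apply/eqP; rewrite -(eqn_pmul2l u0); apply/eqP.
  by rewrite !mulnA ![(u * _)%N]mulnC -av -cs.
have /dvdnP[t bt] : (s %| b)%N.
  by rewrite -(@Gauss_dvdr s v b) ?vbsd ?dvdn_mulr// coprime_sym.
have s0 : (0 < s)%N by move: c0; rewrite cs muln_gt0 => /andP[].
have dt : d = (v * t)%N.
  by apply/eqP; rewrite -(eqn_pmul2l s0) -vbsd bt; apply/eqP; lia.
exists g, g', u, t, v, s; split.
- by rewrite e1 av; lia.
- by rewrite e2 bt; lia.
- by rewrite e3 cs; lia.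
- by rewrite e4 dt; lia.
Qed.

End SquarefreeFactorization.

(** * Quadruples with square product as images of six-tuples *)

Section OffDiagonal.
Variables (x y : nat).
Local Notation K := (x + y).+1.

Definition divides (n : 'I_K) (q : prime_below K) : bool := (val (val q) %| n)%N.

Lemma even4_prime (u v : 'I_K * 'I_K) :
  (0 < u.1)%N -> (0 < u.2)%N -> (0 < v.1)%N -> (0 < v.2)%N ->
  even4 divides u v -> forall q, prime q ->
  (q %| u.1)%N (+) (q %| u.2)%N = (q %| v.1)%N (+) (q %| v.2)%N.
Proof.
move=> u1 u2 v1 v2 /forallP ev q pq.
have [qK|Kq] := ltnP q K.
  have := ev (exist (fun i : 'I_K => prime i) (Ordinal qK) pq).
  rewrite /divides /=.
  by case: (q %| u.1)%N (q %| u.2)%N (q %| v.1)%N (q %| v.2)%N => -[] [] [].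
have no (n : 'I_K) : (0 < n)%N -> (q %| n)%N = false.
  by move=> n0; apply/negP => /dvdn_leq-/(_ n0); have := ltn_ord n; lia.
by rewrite !no.
Qed.

Variable p : nat.
Hypothesis p0 : (0 < p)%N.
Local Notation pairs := ('I_K * 'I_K)%type.

(** [inord] sends values out of range to [0]; only products [p m] in the band matter. *)
Definition scale (m : nat) : 'I_K := inord (p * m).

(* The three ways to read off a quadruple [(n1, n2), (n3, n4)] from a six-tuple;
   they differ by a permutation of [n2, n3, n4]. *)
Definition quad (r : 'I_3) (t : pairs * pairs * pairs) : pairs * pairs :=
  let: (a, a', (b, b'), (c, c')) := t in
  let n1 := scale (a * b * c) in let n2 := scale (a * b' * c') in
  let n3 := scale (a' * b * c') in let n4 := scale (a' * b' * c) in
  match val r with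
  | 0 => ((n1, n2), (n3, n4))
  | 1 => ((n1, n3), (n4, n2))
  | _ => ((n1, n3), (n2, n4))
  end.

(** The common factor [p] is stripped from the four integers before they are factored; its primes
    occur in all four and leave the parities unchanged. The case [p = 1] covers the whole band. *)
Lemma card_off_diagonal (H : {set 'I_K}) :
  (forall n, n \in H -> [/\ squarefree n, (x < n)%N & (p %| n)%N]) ->
  (#|off_diagonal divides H| <= 3 * #|six_tuples x y p K|)%N.
Proof.
move=> HH; set S := six_tuples x y p K.
have sub : off_diagonal divides H \subset
    (\bigcup_(r : 'I_3) [set quad r t | t in S])%SET.
  apply/fintype.subsetP => -[[n1 n2] [n3 n4]].
  rewrite inE /= => /andP[/and4P[]] /HH[s1 x1 d1] /HH[s2 x2 d2] /HH[s3 x3 d3].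
  move=> /HH[s4 x4 d4] /and4P[ev n12 n13 n14].
  have sq0 n : squarefree n -> (0 < n)%N by exact: squarefree_gt0.
  have par := @even4_prime (n1, n2) (n3, n4) (sq0 _ s1) (sq0 _ s2) (sq0 _ s3) (sq0 _ s4) ev.
  have [m1 e1] := dvdnP d1; have [m2 e2] := dvdnP d2.
  have [m3 e3] := dvdnP d3; have [m4 e4] := dvdnP d4.
  have sm n m : squarefree n -> n = (m * p)%N -> squarefree m.
    by move=> sn nm; apply: squarefree_dvd sn _; rewrite nm dvdn_mulr.
  have dm q n m : prime q -> squarefree n -> n = (m * p)%N ->
      (q %| n)%N = (q %| m)%N (+) (q %| p)%N.
    by move=> pq sn nm; rewrite nm squarefree_dvdM -?nm.
  have [q pq|g [g' [u [t [v [s [f1 f2 f3 f4]]]]]]] :=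
      even4_factorization (sm _ _ s1 e1) (sm _ _ s2 e2) (sm _ _ s3 e3) (sm _ _ s4 e4).
    have := par q pq; rewrite /= (dm q n1 m1)// (dm q n2 m2)// (dm q n3 m3)//.
    rewrite (dm q n4 m4)//.
    by case: (q %| m1)%N (q %| m2)%N (q %| m3)%N (q %| m4)%N (q %| p)%N => -[] [] [] [].
  have c1 := ltn_ord n1; have c2 := ltn_ord n2; have c3 := ltn_ord n3; have c4 := ltn_ord n4.
  have E1 : nat_of_ord n1 = (p * (g * u * v))%N by rewrite e1 f1 mulnC.
  have E2 : nat_of_ord n2 = (p * (g * t * s))%N by rewrite e2 f2 mulnC.
  have E3 : nat_of_ord n3 = (p * (g' * u * s))%N by rewrite e3 f3 mulnC.
  have E4 : nat_of_ord n4 = (p * (g' * t * v))%N by rewrite e4 f4 mulnC.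
  have /and5P[g0 u0 v0 t0 /andP[s0 g'0]] :
      [&& 0 < g, 0 < u, 0 < v, 0 < t & (0 < s) && (0 < g')]%N.
    have := sq0 _ s1; have := sq0 _ s2; have := sq0 _ s3.
    rewrite E1 E2 E3 !muln_gt0 p0 /=.
    by case: (0 < g)%N; case: (0 < u)%N; case: (0 < v)%N; case: (0 < t)%N;
      case: (0 < s)%N; case: (0 < g')%N.
  have small (n : 'I_K) k l m : nat_of_ord n = (p * (k * l * m))%N ->
      (0 < k)%N -> (0 < l)%N -> (0 < m)%N ->
      [/\ (k < K)%N, (l < K)%N & (m < K)%N].
    move=> nE k0 l0 m0; have := ltn_ord n; rewrite nE => nK.
    have n0 : (0 < p * (k * l * m))%N by rewrite !muln_gt0 p0 k0 l0.
    split; apply: leq_ltn_trans (dvdn_leq n0 _) nK; apply: dvdn_mull.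
    - by rewrite -mulnA dvdn_mulr.
    - by rewrite mulnAC dvdn_mull.
    - by rewrite dvdn_mull.
  have [gK uK vK] := small _ _ _ _ E1 g0 u0 v0.
  have [_ tK sK] := small _ _ _ _ E2 g0 t0 s0.
  have [g'K _ _] := small _ _ _ _ E3 g'0 u0 s0.
  pose G := Ordinal gK; pose G' := Ordinal g'K; pose U := Ordinal uK.
  pose T := Ordinal tK; pose V := Ordinal vK; pose W := Ordinal sK.
  have scaleE (n : 'I_K) m : nat_of_ord n = (p * m)%N -> scale m = n.
    by move=> nm; apply/val_inj; rewrite /= inordK -nm.
  have bd (n : 'I_K) m : nat_of_ord n = (p * m)%N -> (x < n)%N -> (n < K)%N -> band x y p m.
    by move=> nm xn nK; rewrite /band -nm xn -ltnS.
  (* Each of [n1 != n2], [n1 != n3], [n1 != n4] forbids two of the three pairs to be trivial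
     together, so at most one is; which one decides the reading [r]. *)
  have tp : ~~ ((t == u) && (s == v)).
    apply: contra n12 => /andP[/eqP tu /eqP sv].
    by apply/eqP/val_inj; rewrite /= E1 E2 tu sv.
  have gs : ~~ ((g == g') && (s == v)).
    apply: contra n13 => /andP[/eqP tu /eqP sv].
    by apply/eqP/val_inj; rewrite /= E1 E3 tu sv.
  have gt : ~~ ((g == g') && (t == u)).
    apply: contra n14 => /andP[/eqP tu /eqP sv].
    by apply/eqP/val_inj; rewrite /= E1 E4 tu sv.
  have B1 := bd _ _ E1 x1 c1; have B2 := bd _ _ E2 x2 c2.
  have B3 := bd _ _ E3 x3 c3; have B4 := bd _ _ E4 x4 c4.
  apply/finset.bigcupP.
  have [tu|tu] := eqVneq t u.
    have [gg ss] : g != g' /\ s != v.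
      by move: tp gt; rewrite tu eqxx andbT.
    exists (Ordinal (isT : 2 < 3)%N) => //.
    apply/imsetP; exists ((U, T), (G, G'), (V, W)).
      rewrite inE /is_six_tuple /= [(u * g)%N]mulnC [(u * g')%N]mulnC.
      by rewrite [(t * g)%N]mulnC [(t * g')%N]mulnC B1 B2 B3 B4 -!val_eqE /= gg eq_sym ss.
    rewrite /quad /= [(u * g)%N]mulnC [(u * g')%N]mulnC.
    rewrite [(t * g)%N]mulnC [(t * g')%N]mulnC.
    by rewrite (scaleE _ _ E1) (scaleE _ _ E2) (scaleE _ _ E3) (scaleE _ _ E4).
  have [sv|sv] := eqVneq s v; last first.
    exists (Ordinal (isT : 0 < 3)%N) => //.
    apply/imsetP; exists ((G, G'), (U, T), (V, W)).
      rewrite inE /is_six_tuple /= B1 B2 B3 B4 -!val_eqE /= eq_sym tu eq_sym sv.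
      by [].
    by rewrite /quad /= (scaleE _ _ E1) (scaleE _ _ E2) (scaleE _ _ E3) (scaleE _ _ E4).
  have gg : g != g' by move: gs; rewrite sv eqxx andbT.
  exists (Ordinal (isT : 1 < 3)%N) => //.
  have F1 : (v * g * u = g * u * v)%N by rewrite -mulnA mulnC.
  have F2 : (s * g * t = g * t * s)%N by rewrite -mulnA mulnC.
  have F3 : (s * g' * u = g' * u * s)%N by rewrite -mulnA mulnC.
  have F4 : (v * g' * t = g' * t * v)%N by rewrite -mulnA mulnC.
  apply/imsetP; exists ((V, W), (G, G'), (U, T)).
    by rewrite inE /is_six_tuple /= F1 F2 F3 F4 B1 B2 B3 B4 -!val_eqE /= gg eq_sym tu.
  rewrite /quad /= F1 F2 F3 F4.
  by rewrite (scaleE _ _ E1) (scaleE _ _ E2) (scaleE _ _ E3) (scaleE _ _ E4).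
apply: leq_trans (subset_leq_card sub) _.
have cupU (A B : {set pairs * pairs}) : (#|A :|: B| <= #|A| + #|B|)%N by rewrite cardsU leq_subr.
rewrite !big_ord_recl big_ord0 finset.setU0 !mulSn mul0n addn0.
apply: leq_trans (cupU _ _) (leq_add (leq_imset_card _ _) _).
by apply: leq_trans (cupU _ _) (leq_add (leq_imset_card _ _) (leq_imset_card _ _)).
Qed.

End OffDiagonal.

(** * Large prime factors from a Chebyshev bound *)

Section Primorial.

Lemma leq_prod_subset (s t : seq nat) : uniq s -> {subset s <= t} ->
  (forall p, p \in t -> 0 < p)%N -> (\prod_(p <- s) p <= \prod_(p <- t) p)%N.
Proof.
elim: s t => [|a s IH] t /=.
  by move=> _ _ t0; rewrite big_nil big_seq_cond prodn_cond_gt0// => p /andP[/t0].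
move=> /andP[as_ us] st t0; have at_ : a \in t by rewrite st ?mem_head.
rewrite big_cons (perm_big _ (perm_to_rem at_)) big_cons/= leq_mul2l; apply/orP; right.
apply: IH => // [p ps|p /mem_rem]; last exact: t0.
have pt : p \in t by rewrite st// inE ps orbT.
have := pt; rewrite (perm_mem (perm_to_rem at_)) inE => /orP[/eqP pa|//].
by rewrite -pa ps in as_.
Qed.

Lemma prod_primes_le (n : nat) : (0 < n)%N -> (\prod_(p <- primes n) p <= n)%N.
Proof.
move=> n0; rewrite [leqRHS](prod_prime_decomp n0) /primes /unzip1 big_map.
rewrite big_seq_cond [leqRHS]big_seq_cond; apply: leq_prod => -[p e].
rewrite andbT => /mem_prime_decomp[pp e0 _] /=.
by rewrite -[leqLHS]expn1 leq_pexp2l// prime_gt0.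
Qed.

Lemma squarefree_prod_primes (n : nat) : squarefree n ->
  (n <= \prod_(p <- primes n) p)%N.
Proof.
move=> sn; have n0 := squarefree_gt0 sn.
rewrite [leqLHS](prod_prime_decomp n0) /primes /unzip1 big_map.
rewrite big_seq_cond [leqRHS]big_seq_cond; apply: leq_prod => -[p e].
rewrite andbT => /mem_prime_decomp[pp e0 pen] /=.
rewrite -[leqRHS]expn1 leq_pexp2l ?prime_gt0// leqNgt; apply/negP => e1.
have /squarefreeP/(_ p pp)/negP := sn; apply.
exact: dvdn_trans (dvdn_exp2l p e1) pen.
Qed.

Lemma bin_central_le (m : nat) : ('C(m + m, m) <= 4 ^ m)%N.
Proof.
have -> : (4 ^ m = 2 ^ (m + m))%N by rewrite addnn -mul2n expnM.
rewrite -[2%N]/(1 + 1)%N expnDn.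
have mm : (m < (m + m).+1)%N by rewrite ltnS leq_addr.
by rewrite (bigD1 (Ordinal mm))//= !exp1n !muln1 leq_addr.
Qed.

Definition primes_upto (n : nat) : seq nat := [seq p <- iota 1 n | prime p].

Lemma mem_primes_upto n p : (p \in primes_upto n) = prime p && (p <= n)%N.
Proof.
rewrite mem_filter mem_iota add1n ltnS; case: (boolP (prime p)) => //= pp.
by rewrite prime_gt0.
Qed.

(** Every prime in [(m, 2 m]] divides [(2 m)!] but not [m!], hence divides the central binomial
    coefficient, which is at most [4^m]. *)
Lemma prod_primes_double m : (\prod_(p <- primes_upto (m + m)) p <=
   \prod_(p <- primes_upto m) p * 4 ^ m)%N.
Proof.
rewrite {1}/primes_upto iotaD filter_cat big_cat/= leq_mul2l; apply/orP; right.
apply: leq_trans (bin_central_le m).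
have C0 : (0 < 'C(m + m, m))%N by rewrite bin_gt0 leq_addr.
apply: leq_trans (prod_primes_le C0).
apply: leq_prod_subset => [|p|p].
- by rewrite filter_uniq ?iota_uniq.
- rewrite mem_filter mem_iota => /and3P[pp mp pm].
  rewrite mem_primes pp C0 /=.
  have fact_dvd k : (p %| k`!)%N -> (p <= k)%N.
    elim: k => [|k IH]; first by rewrite fact0 dvdn1 => /eqP p1; rewrite p1 in pp.
    rewrite factS Euclid_dvdM// => /orP[/dvdn_leq-> //|/IH]; exact: leqW.
  have : (p %| (m + m)`!)%N by apply: dvdn_fact; rewrite prime_gt0//=; lia.
  rewrite -(@bin_fact (m + m) m) ?leq_addr// addnK !Euclid_dvdM// orbb.
  by case/orP => // /fact_dvd; lia.
- by rewrite mem_primes => /andP[/prime_gt0].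
Qed.

(** Along powers of [2] the doubling step closes by itself: [4^m * 4^m = 4^(2 m)]. *)
Lemma primorial_pow2 k : (\prod_(p <- primes_upto (2 ^ k)) p <= 4 ^ (2 ^ k))%N.
Proof.
elim: k => [|k IH]; first by rewrite /primes_upto /= big_nil.
rewrite expnS mul2n -addnn; apply: leq_trans (prod_primes_double _) _.
by rewrite expnD leq_mul2r IH orbT.
Qed.

Lemma squarefree_large_prime k n : squarefree n -> (4 ^ (2 ^ k) < n)%N ->
  exists p, [/\ prime p, (p %| n)%N & (2 ^ k < p)%N].
Proof.
move=> sn kn; case: (boolP (all (fun p => p <= 2 ^ k)%N (primes n))); last first.
  case/allPn => p; rewrite mem_primes -ltnNge => /and3P[pp _ pn] kp.
  by exists p.
move=> /allP small; move: kn; rewrite ltnNge.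
rewrite (leq_trans (squarefree_prod_primes sn))//.
apply: leq_trans (primorial_pow2 k); apply: leq_prod_subset.
- exact: primes_uniq.
- move=> p pn; rewrite mem_primes_upto small// andbT.
  by move: pn; rewrite mem_primes => /andP[].
- by move=> p; rewrite mem_primes_upto => /andP[/prime_gt0].
Qed.

End Primorial.

(** * Moments over the squarefree integers of the band *)

Section SecondMoment.
Context {R : realType} {I J : finType}.
Variables (dv : J -> I -> bool) (GG : {set J}).
Hypothesis dv_inj : {in GG &, forall n m, dv n =1 dv m -> n = m}.

Lemma second_moment (H : {set J}) : H \subset GG ->
  sign_mean (fun s => wsum dv H s ^+ 2) = #|H|%:R :> R.
Proof.
move=> /fintype.subsetP HG.
transitivity (sign_mean (fun s => \sum_(n in H) \sum_(m in H)
    walsh (dv n) s * walsh (dv m) s) : R).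
  by apply: eq_sign_mean => s; rewrite expr2 /wsum big_distrlr.
rewrite sign_mean_sum -sum1_card natr_sum; apply: eq_bigr => n nH.
rewrite sign_mean_sum (bigD1 n)//= big1 ?addr0 => [|m /andP[mH mn]].
  under eq_sign_mean do rewrite walsh_sqr.
  by rewrite sign_mean_cst.
under eq_sign_mean do rewrite walshM.
rewrite sign_mean_walsh; apply/eqP; rewrite pnatr_eq0 eqb0.
apply: contra mn => /forallP nm; apply/eqP/esym/dv_inj; rewrite ?HG// => i.
by have := nm i; case: (dv n i) (dv m i) => -[].
Qed.

Lemma norm_wsum_le (H : {set J}) s : `|wsum dv H s| <= #|H|%:R :> R.
Proof.
apply: le_trans (ler_norm_sum _ _ _) _.
rewrite -sum1_card natr_sum; apply: ler_sum => n _.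
have := @walsh_sqr R I (dv n) s; rewrite -expr2 -(real_normK (num_real _)) => /eqP.
by rewrite sqrp_eq1 ?normr_ge0// => /eqP ->.
Qed.

End SecondMoment.

Section Band.
Context {R : realType}.
Variables (x y k : nat) (q0 : prime_below (x + y).+1).
Local Notation K := (x + y).+1.
Local Notation z := (2 ^ k)%N.
Local Notation pv q := (val (val q)).
Hypothesis zx : (4 ^ z <= x)%N.

(** The upper end [n <= x + y] is carried by the type ['I_K]. *)
Definition sqf_band : {set 'I_K} := [set n : 'I_K | squarefree n && (x < n)%N].

(** Any prime factor above [z] will do, so [pick] chooses one; the default [q0] is never reached on
    [GG]. *)
Definition large_prime (n : 'I_K) : prime_below K :=
  odflt q0 [pick q : prime_below K | divides n q && (z < (pv q))%N].

Local Notation dv := (@divides x y).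
Local Notation GG := sqf_band.
Local Notation top := large_prime.

Lemma large_primeP n : n \in GG -> dv n (top n) && (z < (pv (top n)))%N.
Proof.
rewrite inE => /andP[sn xn]; rewrite /top; case: pickP => [//|none].
have [p [pp pn zp]] := squarefree_large_prime sn (leq_ltn_trans zx xn).
have pK : (p < K)%N.
  by apply: leq_ltn_trans (ltn_ord n); apply: dvdn_leq => //; exact: squarefree_gt0.
by have := none (exist (fun i : 'I_K => prime i) (Ordinal pK) pp);
  rewrite /divides /= pn zp.
Qed.

Lemma dv_inj : {in GG &, forall n m, dv n =1 dv m -> n = m}.
Proof.
move=> n m; rewrite !inE => /andP[sn xn] /andP[sm xm] nm.
apply/val_inj/squarefree_eq => // p pp.
have [pK|Kp] := ltnP p K.
  by have := nm (exist (fun i : 'I_K => prime i) (Ordinal pK) pp).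
have no (l : 'I_K) : squarefree l -> (p %| l)%N = false.
  move=> sl; apply/negP => /dvdn_leq-/(_ (squarefree_gt0 sl)).
  by move: Kp; have := ltn_ord l; clear; lia.
by rewrite !no.
Qed.

Lemma dv_top : {in GG, forall n, dv n (top n)}.
Proof. by move=> n /large_primeP/andP[]. Qed.

Lemma val_prime_gt0 (q : prime_below K) : (0 < (pv q))%N.
Proof. by apply: prime_gt0; case: q. Qed.

Lemma card_multiples (q : prime_below K) :
  (#|multiples dv GG q| <= (y %/ (pv q)).+1)%N.
Proof.
have q1 := val_prime_gt0 q; apply: leq_trans (card_progression K x y q1).
have sub : multiples dv GG q \subset
    ((fun c : 'I_K => scale x y (pv q) c) @:
      [pred c : 'I_K | (x < pv q * c <= x + y)%N])%SET.
  apply/fintype.subsetP => n; rewrite !inE => /andP[/andP[sn xn] /dvdnP[c nc]].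
  have n1 := squarefree_gt0 sn; have nK := ltn_ord n.
  have cK : (c < K)%N by apply: leq_ltn_trans nK; rewrite nc leq_pmulr.
  apply/imsetP; exists (Ordinal cK).
    by rewrite inE /= mulnC -nc xn -ltnS.
  by apply/val_inj; rewrite /scale /= mulnC -nc inordK.
apply: leq_trans (subset_leq_card sub) (leq_imset_card _ _).
Qed.

Lemma sum_inv_sqr_primes :
  \sum_(q : prime_below K | (z < (pv q))%N) ((pv q)%:R ^- 2 : R) <= z%:R^-1.
Proof.
apply: le_trans (sum_inv_sqr_tail (R := R) K (expn_gt0 2 k : (0 < z)%N)).
pose Q := [set q : prime_below K | (z < pv q)%N]%SET.
have -> : \sum_(q : prime_below K | (z < pv q)%N) ((pv q)%:R ^- 2 : R) =
    \sum_(i in (val @: Q)%SET) (i%:R ^- 2 : R).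
  rewrite (big_imset (fun i : 'I_K => i%:R ^- 2))/=.
    by apply: eq_bigl => q; rewrite inE.
  by move=> q r _ _; exact: val_inj.
rewrite big_mkcond [leRHS]big_mkcond/=; apply: ler_sum => i _.
case: imsetP => [[q + ->]|_]; first by rewrite inE => ->.
by case: ifP => // _; rewrite invr_ge0 exprn_ge0.
Qed.

Lemma with_top_small (q : prime_below K) : ((pv q) <= z)%N ->
  with_top top GG q = finset.set0.
Proof.
move=> qz; apply/finset.setP => n; rewrite !inE.
apply/negP => /andP[nG /eqP tn].
have /large_primeP/andP[_] : n \in GG by rewrite inE.
by rewrite tn; lia.
Qed.

(** Given [n] with selected prime [q], the multiples [m != n] of [q] number at most [y %/ q]:
    excluding [n] removes the [+ 1], so primes [q > y] contribute nothing. The rest is [2 y^2] times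
    the tail of [1 / q^2]. *)
Lemma card_related_pairs :
  #|related_pairs dv top GG|%:R <= 2 * y%:R ^+ 2 / z%:R :> R.
Proof.
have cP : (#|related_pairs dv top GG| <=
    \sum_(q : prime_below K) #|with_top top GG q| * (y %/ (pv q)))%N.
  rewrite -sum1_card.
  rewrite (partition_big (fun u : 'I_K * 'I_K => top u.1) xpredT)//=.
  apply: leq_sum => q _.
  apply: leq_trans (_ : \sum_(n in with_top top GG q)
      \sum_(m in multiples dv GG q :\ n) 1 <= _)%N.
    rewrite pair_big_dep/= [leqLHS]big_mkcond [leqRHS]big_mkcond/=.
    apply: leq_sum => -[n m] _ /=; rewrite !inE /=.
    case: (boolP (top n == q)) => [/eqP ->|_]; last by rewrite !andbF.
    rewrite !andbT [m == n]eq_sym.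
    by case: (squarefree n && _) => //=; case: (n != m); rewrite //= ?andbF.
  rewrite -sum_nat_const; apply: leq_sum => n nT.
  rewrite sum1_card -ltnS; apply: leq_trans (card_multiples q).
  by rewrite [leqRHS](cardsD1 n) (fintype.subsetP (with_topE dv_top q) _ nT).
apply: le_trans (_ : \sum_(q : prime_below K | (z < (pv q))%N)
    2 * y%:R ^+ 2 * (pv q)%:R ^- 2 <= _); last first.
  by rewrite -mulr_sumr ler_wpM2l ?mulr_ge0 ?exprn_ge0// sum_inv_sqr_primes.
apply: le_trans (_ : (\sum_(q : prime_below K)
    #|with_top top GG q| * (y %/ (pv q)))%N%:R <= _); first by rewrite ler_nat.
rewrite natr_sum [leRHS]big_mkcond; apply: ler_sum => q _.
case: ltnP => zq; last by rewrite with_top_small// cards0 mul0n.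
have q1 := val_prime_gt0 q; have q1' : 0 < (pv q)%:R :> R by rewrite ltr0n.
have le2 : (#|with_top top GG q| * (y %/ (pv q)) <= 2 * (y %/ (pv q)) ^ 2)%N.
  have := leq_trans (subset_leq_card (with_topE dv_top q)) (card_multiples q).
  move: (y %/ (pv q))%N => d cd; case: d cd => [|d] cd; first by rewrite muln0.
  rewrite -mulnn mulnA leq_mul2r; apply/orP; right.
  by apply: leq_trans cd _; lia.
apply: le_trans (_ : (2 * (y %/ (pv q)) ^ 2)%N%:R <= _); first by rewrite ler_nat.
have yq0 : 0 <= y%:R / (pv q)%:R :> R by rewrite divr_ge0.
rewrite natrM natrX -mulrA ler_wpM2l// -exprVn -exprMn lerXn2r ?nnegrE//.
by rewrite ler_pdivlMr// -natrM ler_nat leq_trunc_div.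
Qed.

(* The primes [q > y] divide at most one integer of the band; for the others
   [2 |R| U^2 <= lam R^2 + U^4 / lam]. *)
Lemma sum_third_moments (B lam : R) : 0 <= B -> 0 < lam ->
  (forall q : prime_below K,
    #|off_diagonal dv (multiples dv GG q)|%:R <= B * (y%:R / (pv q)%:R) ^+ 2) ->
  \sum_q sign_mean (fun s =>
      `|wsum dv (with_top top GG q) s| * wsum dv (multiples dv GG q) s ^+ 2)
    <= #|GG|%:R + 2^-1 * (lam * #|GG|%:R + (12 + B) * (y%:R ^+ 2 / z%:R) / lam).
Proof.
move=> B0 lam0 offB.
have subM q : multiples dv GG q \subset GG.
  by apply/fintype.subsetP => n; rewrite inE => /andP[].
have subT q : with_top top GG q \subset GG.
  exact: fintype.subset_trans (with_topE dv_top q) (subM q).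
have cG : \sum_q #|with_top top GG q|%:R = #|GG|%:R :> R.
  rewrite -natr_sum; congr _%:R; rewrite -[RHS]sum1_card.
  rewrite (partition_big top xpredT)//=; apply: eq_bigr => q _.
  by rewrite -sum1_card; apply: eq_bigl => n; rewrite inE.
apply: le_trans (_ : \sum_q (#|with_top top GG q|%:R + 2^-1 * (
    lam * #|with_top top GG q|%:R +
    (if (z < (pv q))%N then (12 + B) * y%:R ^+ 2 * (pv q)%:R ^- 2 else 0) / lam))
    <= _); last first.
  rewrite big_split/= -mulr_sumr big_split/= -mulr_sumr -mulr_suml cG.
  rewrite lerD2l ler_wpM2l ?invr_ge0// lerD2l ler_pM2r ?invr_gt0//.
  rewrite -big_mkcond/= -mulr_sumr [leRHS]mulrA.
  by rewrite ler_wpM2l ?sum_inv_sqr_primes// mulr_ge0 ?exprn_ge0 ?addr_ge0.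
apply: ler_sum => q _.
have q1 := val_prime_gt0 q; have q1' : 0 < (pv q)%:R :> R by rewrite ltr0n.
set T := with_top top GG q; set M := multiples dv GG q.
have rest0 : 0 <= (if (z < (pv q))%N then (12 + B) * y%:R ^+ 2 * (pv q)%:R ^- 2 else 0)
    :> R.
  by case: ifP => // _; rewrite !mulr_ge0 ?exprn_ge0 ?addr_ge0 ?invr_ge0 ?exprn_ge0.
have [qz|zq] := leqP (pv q) z.
  have -> : T = finset.set0 by exact: with_top_small.
  rewrite cards0 add0r mulr0 add0r mul0r mulr0.
  under eq_sign_mean do rewrite /wsum finset.big_set0 normr0 mul0r.
  by rewrite sign_mean_cst.
rewrite zq in rest0.
have [qy|yq] := leqP (pv q) y; last first.
  have M1 : (#|M| <= 1)%N.
    by apply: leq_trans (card_multiples q) _; rewrite divn_small.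
  apply: le_trans (_ : #|T|%:R <= _); last first.
    rewrite lerDl mulr_ge0 ?invr_ge0// addr_ge0//; first by rewrite mulr_ge0// ltW.
    by apply: mulr_ge0 => //; rewrite invr_ge0 ltW.
  rewrite -[leRHS](@sign_mean_cst R (prime_below K)); apply: ler_sign_mean => s.
  rewrite -[leRHS]mulr1 ler_pM ?sqr_ge0 ?norm_wsum_le//.
  rewrite -(real_normK (num_real _)) exprn_ile1 ?normr_ge0//.
  by apply: le_trans (norm_wsum_le _ _ _) _; rewrite lern1.
apply: le_trans (_ : sign_mean (fun s => 2^-1 * (lam * wsum dv T s ^+ 2 +
    lam^-1 * wsum dv M s ^+ 4)) <= _).
  apply: ler_sign_mean => s; set r := wsum dv T s; set u := wsum dv M s.
  rewrite -subr_ge0.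
  have -> : 2^-1 * (lam * r ^+ 2 + lam^-1 * u ^+ 4) - `|r| * u ^+ 2 =
      (lam * `|r| - u ^+ 2) ^+ 2 / (2 * lam).
    rewrite -(real_normK (num_real r)); field.
    by rewrite gt_eqF.
  by rewrite divr_ge0 ?sqr_ge0// mulr_ge0// ltW.
rewrite sign_meanZ sign_meanD !sign_meanZ (second_moment dv_inj (subT q)).
apply: le_trans (_ : 2^-1 * (lam * #|T|%:R + (12 + B) * y%:R ^+ 2 * (pv q)%:R ^- 2 / lam)
    <= _); last by rewrite lerDr.
rewrite ler_wpM2l ?invr_ge0// lerD2l mulrC ler_pM2r ?invr_gt0//.
apply: le_trans (fourth_moment dv_inj (subM q)) _.
rewrite natrD natrM natrX.
(* [12 = 3 * 2^2]: for [q <= y] there are at most [y / q + 1 <= 2 y / q] multiples. *)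
have -> : (12 + B) * y%:R ^+ 2 * (pv q)%:R ^- 2 =
    3 * (2 * (y%:R / (pv q)%:R)) ^+ 2 + B * (y%:R / (pv q)%:R) ^+ 2 :> R.
  by field; rewrite gt_eqF.
have yq0 : 0 <= 2 * (y%:R / (pv q)%:R) :> R by rewrite mulr_ge0// divr_ge0.
rewrite lerD// ler_wpM2l// lerXn2r ?nnegrE//.
apply: le_trans (_ : ((y %/ (pv q)).+1)%:R <= _); first by rewrite ler_nat card_multiples.
rewrite mulrA ler_pdivlMr// -!natrM ler_nat mulSn.
have := leq_trunc_div y (pv q); move: qy; clear; lia.
Qed.

End Band.

(** * Explicit constants for the quadruple count *)

Section CoreBound.
Context {R : realType}.

Lemma ln4_ge1 : 1 <= ln 4 :> R.
Proof.
have h : ln (2^-1) <= - 2^-1 :> R.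
  have := @le_ln1Dx R (- 2^-1); have -> : 1 + - 2^-1 = 2^-1 :> R by field.
  by apply; lra.
have -> : 4 = 2 * 2 :> R by ring.
rewrite lnM ?posrE//; move: h; rewrite lnV ?posrE//; lra.
Qed.

Lemma ln4_le3 : ln 4 <= 3 :> R.
Proof.
have -> : 4 = 1 + 3 :> R by ring.
by apply: le_ln1Dx; lra.
Qed.

(** [k] is the largest exponent with [4^(2^k) <= x]; by maximality [ln x <= 2 * 2^k * ln 4], and
    [ln 4 <= 3] gives the [6]. *)
Lemma dyadic_scale (x : nat) : (4 <= x)%N ->
  exists k, (4 ^ (2 ^ k) <= x)%N /\ ((2 ^ k)%:R^-1 : R) <= 6 / ln x%:R.
Proof.
move=> x4; have ex : exists k, (x < 4 ^ (2 ^ k))%N.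
  exists x; apply: leq_trans (ltn_expl x (isT : 1 < 4)%N) _.
  by rewrite leq_exp2l// ltnW// ltn_expl.
have k0 : (0 < ex_minn ex)%N.
  by case: ex_minnP => -[|m]; rewrite ?expn0 ?expn1; lia.
exists (ex_minn ex).-1; move: k0; case: ex_minnP => -[//|m] xm min _ /=.
split; first by rewrite leqNgt; apply/negP => /min; rewrite ltnn.
have x0 : 0 < x%:R :> R by rewrite ltr0n; lia.
have lx : 0 < ln x%:R :> R by rewrite ln_gt0// ltr1n; lia.
have z0 : 0 < (2 ^ m)%:R :> R by rewrite ltr0n expn_gt0.
rewrite ler_pdivlMr// mulrC ler_pdivrMr//.
have : ln x%:R <= ln ((4 ^ (2 ^ m.+1))%:R) :> R.
  have p4 : 0 < (4 ^ (2 ^ m.+1))%:R :> R by rewrite ltr0n expn_gt0.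
  by rewrite ler_ln ?posrE// ler_nat ltnW.
rewrite natrX lnXn//= => H; apply: le_trans H _.
rewrite -[_ *+ _]mulr_natr expnS natrM.
have : ln 4 * (2 ^ m)%:R <= 3 * (2 ^ m)%:R :> R by rewrite ler_wpM2r // ln4_le3.
lra.
Qed.

Variables (x y : nat).
Local Notation K := (x + y).+1.
Local Notation dv := (@divides x y).
Local Notation L := (ln x%:R : R).
Hypothesis x4 : (4 <= x)%N.
Hypothesis yx : (10 * y <= x)%N.
Hypothesis y0 : (0 < y)%N.
Variable del : R.
Hypothesis ydel : y%:R = del * x%:R.
Hypothesis delL : del * L <= 1.

Let x0 : 0 < x%:R :> R. Proof. by rewrite ltr0n; lia. Qed.
Let L1 : 1 <= L.
Proof. by apply: le_trans ln4_ge1 _; rewrite ler_ln ?posrE// ler_nat. Qed.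
Let del0 : 0 < del.
Proof. by rewrite -(pmulr_lgt0 _ x0) -ydel ltr0n. Qed.

(** The harmonic sum [H] is at most [1 + ln (x + y) <= 3 L], and [del L <= 1] bounds [2 del H + 2]
    by [8]; then [480 = 10 * 8 * 2 * 3]. *)
Lemma six_tuples_bound (p : nat) :
  #|six_tuples x y p K|%:R <= 480 * (del * L) * (y%:R / p%:R) ^+ 2 :> R.
Proof.
apply: le_trans (card_six_tuples _ _ _ yx ydel) _; first by lia.
set H := \sum_(_ < _) _.
have H3 : H <= 3 * L.
  have := @harmonic_le_ln R (x + y).-1; rewrite prednK; last by lia.
  rewrite -/H => HL; apply: le_trans HL _.
  have xy0 : 0 < (x + y)%:R :> R by rewrite ltr0n; lia.
  have : ln (1 + y%:R / x%:R) <= 1 :> R.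
    apply: le_trans (le_ln1Dx _) _; first by apply: lt_le_trans (ltrN10 _) _; rewrite divr_ge0.
    by rewrite ler_pdivrMr// mul1r ler_nat; lia.
  have -> : 1 + y%:R / x%:R = (x + y)%:R / x%:R :> R.
    by rewrite natrD; field; rewrite gt_eqF.
  rewrite ln_div ?posrE//; have := L1.
  by move: (ln (x + y)%:R : R) (ln x%:R : R) => a b; lra.
have H0 : 0 <= H by apply: sumr_ge0 => i _; rewrite invr_ge0.
have dH : del * H <= 3 * (del * L).
  by rewrite [leRHS]mulrCA ler_wpM2l// ltW.
have dH0 : 0 <= del * H by rewrite mulr_ge0// ltW.
rewrite [leRHS]mulrC -mulrA mulrCA ler_wpM2l ?sqr_ge0//.
move: dH dH0 delL; rewrite -!mulrA; move: (del * H) (del * L) => u v uv u0 v1.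
have : (2 * u + 2) * (2 * u) <= 8 * (2 * u).
  by rewrite ler_wpM2r ?mulr_ge0//; lra.
lra.
Qed.

Lemma off_diagonal_bound (p : nat) (H : {set 'I_K}) : (0 < p)%N ->
  (forall n, n \in H -> [/\ squarefree n, (x < n)%N & (p %| n)%N]) ->
  #|off_diagonal dv H|%:R <= 1440 * (del * L) * (y%:R / p%:R) ^+ 2 :> R.
Proof.
move=> p0 HH.
apply: le_trans (_ : (3 * #|six_tuples x y p K|)%N%:R <= _).
  by rewrite ler_nat; exact: card_off_diagonal.
rewrite natrM; have := six_tuples_bound p.
have : 0 <= (y%:R / p%:R) ^+ 2 :> R by exact: sqr_ge0.
move: (#|_|%:R : R) ((y%:R / p%:R) ^+ 2 : R) (del * L) => a b c; lra.
Qed.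

End CoreBound.

(** * The Stein discrepancy of the band *)

Section Discrepancy.
Context {R : realType}.
Variables (x y k : nat) (q0 : prime_below (x + y).+1).
Local Notation K := (x + y).+1.
Local Notation GG := (sqf_band x y).
Local Notation dv := (@divides x y).
Local Notation top := (@large_prime x y k q0).
Local Notation L := (ln x%:R : R).
Hypothesis x4 : (4 <= x)%N.
Hypothesis zx : (4 ^ (2 ^ k) <= x)%N.
Hypothesis zL : ((2 ^ k)%:R^-1 : R) <= 6 / ln x%:R.
Hypothesis yx : (10 * y <= x)%N.
Hypothesis y0 : (0 < y)%N.
Variable del : R.
Hypothesis ydel : y%:R = del * x%:R.
Hypothesis delL : del * L <= 1.

(** Common majorant for the variance of [sum_p R_p U_p] and for the summed fourth moments of the
    [U_p]. The square [100^2] exceeds [6 * (12 + 1440) = 8712], the largest constant that occurs,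
    and comes out of the square root as [100]. *)
Definition error_scale : R := 100 ^+ 2 * y%:R ^+ 2 * (L^-1 + del * L).

Lemma discrepancy_bound (g dg : R -> R) (C S : R) :
  (forall t : R, is_derive t 1 g (dg t)) -> (forall t, `|dg t| <= C) ->
  (forall t u, `|dg t - dg u| <= C * `|t - u|) ->
  1 <= S -> #|GG|%:R <= S -> S <= #|GG|%:R + 1 ->
  `|sign_mean (fun s => dg (normalized dv GG S s) -
      normalized dv GG S s * g (normalized dv GG S s))| <=
  3 * C * (Num.sqrt error_scale / S + 1 / Num.sqrt S).
Proof.
move=> gE dgC dgL S1 GS SG.
have C0 : 0 <= C by apply: le_trans (dgC 0).
have S0 : 0 < S by apply: lt_le_trans S1.
have x0 : 0 < x%:R :> R by rewrite ltr0n; lia.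
have y0' : 0 < y%:R ^+ 2 :> R by rewrite exprn_gt0// ltr0n.
have L0 : 0 < L.
  by rewrite ln_gt0// ltr1n; move: x4; clear; lia.
have del0 : 0 < del by rewrite -(pmulr_lgt0 _ x0) -ydel ltr0n.
have dL0 : 0 < del * L by rewrite mulr_gt0.
have iL0 : 0 < L^-1 by rewrite invr_gt0.
have yz : y%:R ^+ 2 / (2 ^ k)%:R <= 6 * (y%:R ^+ 2 * L^-1) :> R.
  by rewrite mulrCA ler_wpM2l// ltW.
have yL0 : 0 < y%:R ^+ 2 * L^-1 by rewrite mulr_gt0.
have ydL0 : 0 < y%:R ^+ 2 * (del * L) by rewrite mulr_gt0.
have QE : error_scale = 100 ^+ 2 * (y%:R ^+ 2 * L^-1 + y%:R ^+ 2 * (del * L)).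
  by rewrite /error_scale; ring.
have Q0 : 0 < error_scale.
  by rewrite QE pmulr_rgt0; [exact: addr_gt0|rewrite exprn_gt0// ltr0n].
have dvi := @dv_inj x y; have dvt := dv_top q0 zx.
pose T s := \sum_q wsum dv (with_top top GG q) s * wsum dv (multiples dv GG q) s : R.
have ET : sign_mean (fun s => `|T s - #|GG|%:R|) <= Num.sqrt error_scale.
  apply: sign_mean_norm_sqrt => //.
  have V := variance_bound (R := R) dvi dvt; apply: le_trans V _.
  have P2 := card_related_pairs (R := R) q0 zx.
  have := off_diagonal_bound x4 yx y0 ydel delL (ltn0Sn 0) (H := GG).
  move=> /(_ _); rewrite divr1 => O2.
  have {}O2 : #|off_diagonal dv GG|%:R <= 1440 * (y%:R ^+ 2 * (del * L)) :> R.
    rewrite [y%:R ^+ 2 * _]mulrC mulrA.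
    by apply: O2 => n; rewrite inE => /andP[].
  rewrite -[2 * _ / _]mulrA in P2.
  rewrite natrD natrM QE; move: P2 O2 yz yL0 ydL0.
  move: (#|related_pairs dv top GG|%:R : R) (#|off_diagonal dv GG|%:R : R).
  move: (y%:R ^+ 2 / (2 ^ k)%:R : R) (y%:R ^+ 2 * L^-1) (y%:R ^+ 2 * (del * L)).
  by move=> u v w P O; lra.
have a0 : 0 < Num.sqrt error_scale by rewrite sqrtr_gt0.
have b0 : 0 < Num.sqrt S by rewrite sqrtr_gt0.
have aa : Num.sqrt error_scale * Num.sqrt error_scale = error_scale.
  by rewrite -expr2 sqr_sqrtr// ltW.
have bb : Num.sqrt S * Num.sqrt S = S by rewrite -expr2 sqr_sqrtr// ltW.
have b1 : 1 <= Num.sqrt S by rewrite -[leLHS]sqrtr1 ler_wsqrtr.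
(* Replacing [#|GG|] by [S] moves the centre by at most [1], whence the [+ 1]. *)
have first : sign_mean (fun s => `|1 - T s / S|) <= (Num.sqrt error_scale + 1) / S.
  apply: le_trans (_ : sign_mean (fun s => S^-1 * (`|T s - #|GG|%:R| + 1)) <= _).
    apply: ler_sign_mean => s.
    have -> : 1 - T s / S = S^-1 * (S - T s) by field; rewrite gt_eqF.
    rewrite normrM ger0_norm ?invr_ge0 ?ler_wpM2l ?invr_ge0 ?(ltW S0)//.
    have -> : S - T s = - (T s - #|GG|%:R) + (S - #|GG|%:R) by ring.
    apply: le_trans (ler_normD _ _) _; rewrite normrN lerD2l.
    by rewrite ger0_norm ?subr_ge0// lerBlDl.
  rewrite sign_meanZ sign_meanD sign_mean_cst mulrC ler_wpM2r ?invr_ge0 ?(ltW S0)//.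
  by rewrite lerD2r.
(* Balances the two terms: [lam S] and [error_scale / lam] both equal [sqrt (error_scale * S)]. *)
pose lam := Num.sqrt error_scale / Num.sqrt S.
have lam0 : 0 < lam by rewrite divr_gt0.
(* Here [del L] is only bounded by [1]: the gain comes from the tail of [1 / q^2] over the large
   primes. *)
have offq (q : prime_below K) : #|off_diagonal dv (multiples dv GG q)|%:R <=
    1440 * (y%:R / (val (val q))%:R) ^+ 2 :> R.
  apply: le_trans (off_diagonal_bound x4 yx y0 ydel delL (val_prime_gt0 q) _) _.
    by move=> n; rewrite !inE => /andP[/andP[sn xn] dn].
  apply: ler_wpM2r; first exact: sqr_ge0.
  by apply: ler_piMr; [exact: ler0n|exact: delL].
have third := sum_third_moments q0 zx (ler0n R 1440) lam0 offq.
have third' : \sum_q sign_mean (fun s =>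
      `|wsum dv (with_top top GG q) s| * wsum dv (multiples dv GG q) s ^+ 2)
    <= S + Num.sqrt error_scale * Num.sqrt S.
  apply: le_trans third _; apply: lerD => //.
  have h1 : lam * #|GG|%:R <= Num.sqrt error_scale * Num.sqrt S.
    apply: le_trans (_ : lam * S <= _); first by rewrite ler_wpM2l// ltW.
    by rewrite /lam -{2}bb mulrA divfK ?gt_eqF.
  have h2 : (12 + 1440) * (y%:R ^+ 2 / (2 ^ k)%:R) / lam <= Num.sqrt error_scale * Num.sqrt S.
    rewrite ler_pdivrMr//.
    have -> : Num.sqrt error_scale * Num.sqrt S * lam = error_scale.
      by rewrite -[RHS]aa /lam; field; rewrite gt_eqF.
    rewrite QE; move: yz yL0 ydL0.
    move: (y%:R ^+ 2 / (2 ^ k)%:R : R) (y%:R ^+ 2 * L^-1) (y%:R ^+ 2 * (del * L)).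
    by move=> u v w; lra.
  by rewrite ler_pdivrMl// mulr_natl mulr2n; exact: lerD.
apply: le_trans (stein_discrepancy dvt gE dgC dgL S0) _.
apply: le_trans (lerD (ler_wpM2l C0 first) (ler_wpM2l _ third')) _.
  by rewrite divr_ge0 ?mulr_ge0 ?(ltW S0) ?(ltW b0).
move: (Num.sqrt error_scale) (Num.sqrt S) b0 b1 bb => a b b0 b1 bb.
rewrite -bb -subr_ge0.
have -> : 3 * C * (a / (b * b) + 1 / b) - (C * ((a + 1) / (b * b)) +
    2 * C / (b * b * b) * (b * b + a * b)) = C * (b - 1) / (b * b).
  by field; rewrite gt_eqF.
by rewrite divr_ge0 ?mulr_ge0 ?subr_ge0 ?(ltW b0).
Qed.

End Discrepancy.

(** * The main estimate *)

Section Transfer.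
Context {R : realType}.
Variables (x y : nat).
Local Notation K := (x + y).+1.
Local Notation GG := (sqf_band x y).
Local Notation dv := (@divides x y).

Lemma squarefree_ext_walsh (f : nat -> R) (s : {ffun prime_below K -> bool})
    (n : 'I_K) : (forall q : prime_below K, f (val (val q)) = (-1) ^+ s q) ->
  squarefree n -> squarefree_ext f n = walsh (dv n) s.
Proof.
move=> fs sn; rewrite /squarefree_ext sn.
pose ps := [seq val (val q) | q <- enum [pred q : prime_below K | dv n q]].
have -> : walsh (dv n) s = \prod_(p <- ps) f p.
  rewrite big_map big_enum/= /walsh [RHS]big_mkcond/=; apply: eq_bigr => q _.
  by rewrite inE fs; case: (dv n q).
have n0 := squarefree_gt0 sn.
apply: perm_big; apply: uniq_perm; first exact: primes_uniq.
  by rewrite map_inj_uniq ?enum_uniq//; apply: inj_comp val_inj val_inj.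
move=> p; apply/idP/mapP => [|[q]].
  rewrite mem_primes => /and3P[pp _ pn].
  have pK : (p < K)%N by apply: leq_ltn_trans (dvdn_leq n0 pn) _.
  exists (exist (fun i : 'I_K => prime i) (Ordinal pK) pp) => //.
  by rewrite mem_enum inE.
rewrite mem_enum inE => qn ->; rewrite mem_primes n0; apply/and3P; split=> //.
by case: q {qn}.
Qed.

Lemma sum_squarefree_ext (f : nat -> R) (s : {ffun prime_below K -> bool}) :
  (forall q : prime_below K, f (val (val q)) = (-1) ^+ s q) ->
  \sum_(x.+1 <= n < K) squarefree_ext f n = wsum dv GG s.
Proof.
move=> fs; rewrite big_geq_mkord/= /wsum big_mkcond [RHS]big_mkcond/=.
apply: eq_bigr => n _; rewrite inE; case: (ltnP x n) => xn; rewrite ?andbF// andbT.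
case: (boolP (squarefree n)) => sn; first exact: squarefree_ext_walsh.
by rewrite /squarefree_ext (negbTE sn).
Qed.

Lemma squarefree_countE :
  squarefree_count x y = (squarefree x + #|GG|)%N.
Proof.
rewrite /squarefree_count /index_iota subSn ?leq_addr//= -/(iota x.+1 _).
congr (_ + _)%N; rewrite -sum1_count -sum1_card.
rewrite (_ : iota x.+1 _ = index_iota x.+1 K); last by rewrite /index_iota subSS.
rewrite big_geq_mkord/=; apply: eq_bigl => n; rewrite inE andbC.
by [].
Qed.

Lemma measurable_squarefree_ext d (T : measurableType d) (P : probability T R)
    (X : nat -> {RV P >-> R}) (n : nat) :
  measurable_fun setT (fun w => squarefree_ext (fun p => X p w) n).
Proof.
rewrite /squarefree_ext; case: (squarefree n); last exact: measurable_cst.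
by apply: measurable_prod => p _.
Qed.

(** The normalized sum has second moment [#|GG| / S <= 1]. This yields the entry [1] of the minimum
    and settles the range [delta ln x > 1]. *)
Lemma sign_mean_lipschitz_trivial (phi : R -> R) (c C S : R) :
  (forall a b, `|phi a - phi b| <= `|a - b|) -> `|phi 0 - c| <= C ->
  0 < S -> #|GG|%:R <= S ->
  `|sign_mean (fun s => phi (normalized dv GG S s)) - c| <= 1 + C.
Proof.
move=> lip cC S0 GS.
have -> : sign_mean (fun s => phi (normalized dv GG S s)) - c =
    sign_mean (fun s => phi (normalized dv GG S s) - phi 0) + (phi 0 - c).
  have -> : sign_mean (fun s => phi (normalized dv GG S s)) =
      sign_mean (fun s => (phi (normalized dv GG S s) - phi 0) + phi 0).
    by apply: eq_sign_mean => s; rewrite subrK.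
  by rewrite sign_meanD sign_mean_cst addrA.
apply: le_trans (ler_normD _ _) (lerD _ cC).
apply: le_trans (ler_norm_sign_mean _) _.
apply: (@le_trans _ _ (sign_mean (fun s => `|normalized dv GG S s|))).
  by apply: ler_sign_mean => s; apply: le_trans (lip _ _) _; rewrite subr0.
rewrite -[leRHS]sqrtr1; apply: sign_mean_norm_sqrt => //.
apply: (@le_trans _ _ (sign_mean (fun s => S^-1 * wsum dv GG s ^+ 2))).
  apply: ler_sign_mean => s; rewrite /normalized exprMn expr_div_n sqr_sqrtr ?(ltW S0)//.
  by rewrite expr1n div1r.
rewrite sign_meanZ (second_moment (@dv_inj x y) (fintype.subxx _)).
by rewrite mulrC ler_pdivrMr// mul1r.
Qed.

End Transfer.

(** * Comparison with the stated rate *)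

Section Rate.
Context {R : realType}.

Lemma powR_3_2 (a : R) : 0 < a -> a `^ (3 / 2) = a * Num.sqrt a.
Proof.
move=> a0; have -> : 3 / 2 = 1 + 2^-1 :> R by field.
by rewrite powRD ?gt_eqF ?implybT// powRr1 ?ltW// powR12_sqrt// ltW.
Qed.

Lemma powR_1_2 (a : R) : 0 <= a -> a `^ (1 / 2) = Num.sqrt a.
Proof. by move=> a0; rewrite div1r powR12_sqrt. Qed.

(** From [y / S >= 1/2], a factor [sqrt (y / S)] can be inserted in the first term at a cost of [2],
    and [d1 <= L] replaces [L] by [d1]. In the last term [y L / (S l) >= 1/2] absorbs
    [1 / sqrt S]. *)
Lemma rate_bound (y S del L l d1 : R) :
  0 < y -> 1 <= S -> S <= 2 * y -> 0 < del -> 0 < L -> 0 < d1 -> d1 <= L ->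
  0 < l -> l <= L ->
  let Q := 100 ^+ 2 * y ^+ 2 * (L^-1 + del * L) in
  Num.sqrt Q / S + 1 / Num.sqrt S <= 200 *
    ((y / S) `^ (3 / 2) * (1 / d1 `^ (1 / 2)) + y / S * Num.sqrt (del * L)
      + y * L / (S `^ (3 / 2) * l)).
Proof.
move=> y0 S1 Sy del0 L0 d10 d1L l0 lL.
have S0 : 0 < S by apply: lt_le_trans S1.
set r := y / S; have r0 : 0 < r by rewrite divr_gt0.
have r2 : 2^-1 <= r by rewrite /r ler_pdivlMr//; lra.
have sr : 2^-1 <= Num.sqrt r.
  have -> : 2^-1 = Num.sqrt (2^-1 ^+ 2) :> R by rewrite sqrtr_sqr ger0_norm.
  by apply: ler_wsqrtr; apply: le_trans r2; rewrite expr2; lra.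
have dL0 : 0 < del * L by rewrite mulr_gt0.
have iL0 : 0 < L^-1 by rewrite invr_gt0.
rewrite powR_3_2// powR_3_2// powR_1_2 ?(ltW d10)//=.
set sL := Num.sqrt L; have sL0 : 0 < sL by rewrite sqrtr_gt0.
set sS := Num.sqrt S; have sS0 : 0 < sS by rewrite sqrtr_gt0.
set sd := Num.sqrt d1; have sd0 : 0 < sd by rewrite sqrtr_gt0.
have sdL : sd <= sL by apply: ler_wsqrtr.
set e := Num.sqrt (del * L).
have e0 : 0 <= e by exact: sqrtr_ge0.
have isL : Num.sqrt L^-1 = sL^-1 by rewrite sqrtrV ?ltW.
have Qle : Num.sqrt (100 ^+ 2 * y ^+ 2 * (L^-1 + del * L)) <= 100 * y * (sL^-1 + e).
  rewrite -exprMn sqrtrM ?sqr_ge0// sqrtr_sqr ger0_norm ?mulr_ge0 ?ler0n ?(ltW y0)//.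
  apply: ler_wpM2l; first by rewrite mulr_ge0 ?ler0n ?(ltW y0).
  rewrite -[leRHS]ger0_norm ?addr_ge0 ?invr_ge0 ?(ltW sL0)// -sqrtr_sqr.
  apply: ler_wsqrtr; rewrite sqrrD -isL !sqr_sqrtr ?(ltW iL0) ?(ltW dL0)//.
  by rewrite addrAC lerDl mulrn_wge0// mulr_ge0// sqrtr_ge0.
have b1 : r / sL <= 2 * (r * Num.sqrt r * (1 / sd)).
  rewrite div1r ler_pdivrMr// -[X in X <= _]mulr1.
  have -> : 2 * (r * Num.sqrt r / sd) * sL = r * ((2 * Num.sqrt r) * (sL / sd)).
    by field; rewrite gt_eqF.
  rewrite ler_wpM2l ?(ltW r0)// -[leLHS]mulr1 ler_pM//; first by lra.
  by rewrite ler_pdivlMr// mul1r.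
have b3 : 1 / sS <= 2 * (y * L / (S * sS * l)).
  have -> : y * L / (S * sS * l) = r * (L / l) * (1 / sS).
    by rewrite /r; field; rewrite !gt_eqF.
  rewrite mulrA ler_peMl ?divr_ge0 ?(ltW sS0)//.
  have : 2^-1 * 1 <= r * (L / l).
    by rewrite ler_pM ?invr_ge0// ler_pdivlMr// mul1r.
  lra.
have b2 : 0 <= r * e by rewrite mulr_ge0// ltW.
have Qr : Num.sqrt (100 ^+ 2 * y ^+ 2 * (L^-1 + del * L)) / S <= 100 * (r / sL + r * e).
  apply: le_trans (_ : 100 * y * (sL^-1 + e) / S <= _).
    by rewrite ler_wpM2r// invr_ge0 ltW.
  by rewrite le_eqVlt; apply/orP; left; apply/eqP; rewrite /r; ring.
have b30 : 0 < 1 / sS by rewrite divr_gt0.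
move: Qr b1 b2 b3 b30.
move: (Num.sqrt (100 ^+ 2 * _ * _) / S) (r / sL) (r * e) (1 / sS).
move: (r * Num.sqrt r * (1 / sd)) (y * L / (S * sS * l)).
clear; move=> B1 B3 Q A B2 A3; lra.
Qed.

End Rate.

Unset Implicit Arguments.

Theorem theorem1p1 (R : realType) :
  exists C : R, exists N : nat,
  forall (d : measure_display) (T : measurableType d) (P : probability T R)
    (X : nat -> {RV P >-> R})
    (d' : measure_display) (T' : measurableType d') (Q : probability T' R)
    (Z : {RV Q >-> R})
    (x y : nat) (delta : R) (phi : R -> R),
  mutually_independent [set p | prime p] X ->
  (forall p : nat, prime p ->
     P [set w | X p w = 1] = (1 / 2)%:E /\ P [set w | X p w = -1] = (1 / 2)%:E) ->
  is_standard_gaussian Z ->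
  (N <= x)%N -> (N <= y)%N ->
  y%:R = delta * x%:R -> delta < 1 / 10 ->
  (forall a b : R, `|phi a - phi b| <= `|a - b|) ->
  (0 < squarefree_count x y)%N ->
  let S : R := (squarefree_count x y)%:R in
  (`| 'E_P[(fun w => phi (1 / Num.sqrt S *
              \sum_(x.+1 <= n < (x + y).+1) squarefree_ext (fun p => X p w) n)%R)]
     - 'E_Q[(fun w => phi (Z w))] |
   <= (C * Num.min 1
         ((y%:R / S) `^ (3 / 2) * (1 / (ln (1 / delta)) `^ (1 / 2))
          + y%:R / S * Num.sqrt (delta * ln x%:R)
          + y%:R * ln x%:R / (S `^ (3 / 2) * ln y%:R)))%:E)%E.
Proof.
have [C C0 stein] := @stein_solution R.
(* [600 = 3 * 200] from [discrepancy_bound] and [rate_bound]; [1 + C] serves the trivial bound. The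
   threshold [4] is that of [dyadic_scale], and makes the logarithms positive and [y + 1 <= 2 y]. *)
exists (600 * (1 + C)), 4%N.
move=> d T P X d' T' Q Z x y delta phi indep half gZ Nx Ny ydel del10 lip cnt0.
lazy zeta.
set S : R := (squarefree_count x y)%:R.
have [c [g [dg [Ec gE dgE dgC dgL]]]] := stein phi d' T' Q Z gZ lip.
have x0 : 0 < x%:R :> R by rewrite ltr0n (leq_trans _ Nx).
have y0 : 0 < y%:R :> R by rewrite ltr0n (leq_trans _ Ny).
have del0 : 0 < delta by rewrite -(pmulr_lgt0 _ x0) -ydel.
have yx : (10 * y <= x)%N.
  rewrite -(ler_nat R) natrM ydel mulrA; apply: ler_piMl; first exact: ltW.
  by move: del10; lra.
have S1 : 1 <= S by rewrite ler1n.
have S0 : 0 < S by apply: lt_le_trans S1.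
have SE : S = (squarefree x)%:R + #|sqf_band x y|%:R.
  by rewrite /S squarefree_countE natrD.
have sq1 : 0 <= ((squarefree x)%:R : R) <= 1 by rewrite ler0n lern1; case: (squarefree x).
have GS : #|sqf_band x y|%:R <= S by move: sq1; rewrite SE; lra.
have SG : S <= #|sqf_band x y|%:R + 1 by move: sq1; rewrite SE; lra.
have Sy : S <= 2 * y%:R.
  rewrite -(natrM R 2) ler_nat.
  apply: leq_trans (count_size _ _) _.
  by rewrite size_iota; move: Ny; clear; lia.
pose F s : R := phi (normalized (@divides x y) (sqf_band x y) S s).
have EP : ('E_P[(fun w => phi (1 / Num.sqrt S *
    \sum_(x.+1 <= n < (x + y).+1) squarefree_ext (fun p => X p w) n)%R)] =
    (sign_mean F)%:E)%E.
  apply: (expectation_signs indep half) => [|s w Xs].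
    apply: (@measurableT_comp _ _ _ _ _ _ phi); first exact: measurable_lipschitz.
    apply: measurable_funM; first exact: measurable_cst.
    apply: measurable_sum => n; exact: measurable_squarefree_ext.
  by rewrite /F /normalized -(sum_squarefree_ext (f := fun p => X p w)).
rewrite EP Ec -EFinB /= lee_fin.
set B := _ + _ + _.
have L0 : 0 < ln x%:R :> R by rewrite ln_gt0// ltr1n (leq_trans _ Nx).
have l0 : 0 < ln y%:R :> R by rewrite ln_gt0// ltr1n (leq_trans _ Ny).
have lL : ln y%:R <= ln x%:R :> R.
  by rewrite ler_ln ?posrE// ler_nat; move: yx; clear; lia.
have d1E : 1 / delta = x%:R / y%:R by rewrite ydel; field; rewrite !gt_eqF.
have d10 : 0 < ln (1 / delta).
  by rewrite ln_gt0// ltr_pdivlMr// mul1r (lt_trans del10)//; lra.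
have d1L : ln (1 / delta) <= ln x%:R.
  rewrite d1E ler_ln ?posrE ?divr_gt0// ler_pdivrMr// ler_peMr ?(ltW x0)//.
  by rewrite ler1n (leq_trans _ Ny).
have triv : `|sign_mean F - c| <= 1 + C.
  apply: sign_mean_lipschitz_trivial => //.
  (* At [t = 0] the equation reads [phi 0 - c = dg 0], which is bounded by [C]. *)
  by have := dgE 0; rewrite mul0r subr0 => <-.
have B0 : 0 <= B.
  rewrite /B !addr_ge0 ?mulr_ge0 ?invr_ge0 ?mulr_ge0 ?powR_ge0 ?sqrtr_ge0 ?invr_ge0
    ?powR_ge0 ?(ltW y0) ?(ltW L0) ?(ltW l0) ?(ltW S0)//.
have C1 : 0 < 1 + C by apply: ltr_pwDl.
have main : `|sign_mean F - c| <= 600 * (1 + C) * B.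
  (* When [delta ln x > 1] the second term of [B] is at least [1/2] and the trivial bound is enough;
     otherwise the quadruple count applies. *)
  have [delL|delL] := leP (delta * ln x%:R) 1; last first.
    have B2 : 2^-1 <= B.
      apply: (@le_trans _ _ (y%:R / S * Num.sqrt (delta * ln x%:R))).
        rewrite -[leLHS]mulr1; apply: ler_pM; rewrite ?invr_ge0//.
          by rewrite ler_pdivlMr//; move: Sy; lra.
        by rewrite -[leLHS]sqrtr1; apply: ler_wsqrtr; exact: ltW.
      rewrite /B addrAC lerDr addr_ge0//.
        by rewrite mulr_ge0 ?powR_ge0// div1r invr_ge0 powR_ge0.
      rewrite divr_ge0 ?mulr_ge0 ?powR_ge0 ?(ltW y0) ?(ltW L0) ?(ltW l0)//.
    apply: le_trans triv _; move: C1 B2; move: (1 + C) (B) => u v u0 v2.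
    have : u * 2^-1 <= u * v by rewrite ler_wpM2l// ltW.
    have : 0 <= u * v by rewrite mulr_ge0 ?(ltW u0)// (le_trans _ v2).
    lra.
  have [k [zx zL]] := @dyadic_scale R x Nx.
  have K2 : (2 < (x + y).+1)%N by move: Nx; clear; lia.
  (* The prime [2] is just the default value of [large_prime]. *)
  pose q0 : prime_below (x + y).+1 :=
    exist (fun i : 'I_(x + y).+1 => prime i) (Ordinal K2) (isT : prime 2).
  have y1 : (0 < y)%N by rewrite (leq_trans _ Ny).
  have := discrepancy_bound q0 Nx zx zL yx y1 ydel delL gE dgC dgL S1 GS SG.
  have -> : sign_mean (fun s => dg (normalized (@divides x y) (sqf_band x y) S s) -
      normalized (@divides x y) (sqf_band x y) S s *
      g (normalized (@divides x y) (sqf_band x y) S s)) = sign_mean F - c.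
    rewrite -[X in _ - X](@sign_mean_cst R (prime_below (x + y).+1)).
    rewrite -mulN1r -sign_meanZ -sign_meanD.
    by apply: eq_sign_mean => s; rewrite dgE mulN1r.
  have := rate_bound y0 S1 Sy del0 L0 d10 d1L l0 lL; lazy zeta.
  rewrite -/(error_scale x y delta) -/B => rB h; apply: le_trans h _.
  move: rB C0 B0; move: (_ + 1 / Num.sqrt S) (B) => u v uv c0 v0.
  have : 3 * C * u <= 3 * C * (200 * v) by rewrite ler_wpM2l// mulr_ge0.
  have : 0 <= C * v by rewrite mulr_ge0.
  lra.
rewrite minEle; case: ifP => // _; rewrite mulr1; apply: le_trans triv _.
by move: C1; lra.
Qed.
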